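(* Let $g=\sum_i\alpha_i\mathbf 1_{(t_i,t_{i+1})}$ be a piecewise constant function on $[0,1]$, and let $\kappa$ be the support size of a convolution kernel $K$ on $\mathbb R$ that is symmetric, compactly supported, nonnegative, positive in a neighborhood of the origin, and of total mass $1$. Let $X^k=\{x_1,\dots,x_n\}\subset[0,1]$ be a discretization set of mesh size $\eta=\max_i|x_i-x_{i-1}|$, and assume that $$\kappa+\eta\le\frac{h_{\min}\,l_{\min}}{2(8h_{\max}+h_{\min})}.$$ Let $g^k=\sum_i\alpha_i\mathbf 1_{(s_i,s_{i+1})}$ be an $X^k$-discretization of $g$, where $s_i\in X^k$ is a nearest neighbor of the jump location $t_i$ of $g$. Consider data $f^k=\sum_jS_kf(j)\,\mathbf 1_{I_j}$ obtained from sampling $f=K*g$ on $X^k$ using integral sampling or point sampling at the midpoints. Then each such function $g^k$ is a minimizer of the discrete Potts functional $P^k_\gamma$ associated with the data $f^k$, i.e. $$P^k_\gamma(g^k)=\inf_{u\in\mathrm{PC}^k[0,1]}P^k_\gamma(u)=\inf_{u\in\mathrm{PC}^k[0,1]}\ \gamma J(u)+\|u-f^k\|_1,$$ for any Potts parameter $\gamma$ satisfying $$2(\kappa+\eta)h_{\max}\le\gamma\le\tfrac12h_{\min}l_{\min}-(h_{\min}+6h_{\max})(\kappa+\eta).$$ The $X^k$-discretizations $g^k=\sum_i\alpha_i\mathbf 1_{(s_i,s_{i+1})}$ of $g$, with each $s_i\in X^k$ a nearest neighbor of the jump location $t_i$ of $g$, are the only minimizers; hence the minimizer is unique whenever each jump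 location $t_i$ of $g$ has a unique nearest neighbor in $X^k$. Furthermore, if $(X^k)_k$ is a nested sequence of discretization sets whose union is dense in $[0,1]$ and such that, for every $k$, the mesh size $\eta_k$ of $X^k$ satisfies $\kappa+\eta_k\le\frac{h_{\min}\,l_{\min}}{2(8h_{\max}+h_{\min})}$ and the Potts parameter $\gamma$ satisfies $2(\kappa+\eta_k)h_{\max}\le\gamma\le\tfrac12h_{\min}l_{\min}-(h_{\min}+6h_{\max})(\kappa+\eta_k)$, then each sequence of minimizers $(g^k)$ converges to $g$ in $L^1[0,1]$.
   Context: $\mathrm{PC}[0,1]\subset L^1[0,1]$ is the set of (equivalence classes of) piecewise constant functions on $[0,1]$ with finitely many jumps, $J(u)$ is the number of jumps of $u$ in $(0,1)$, and $\mathrm{PC}^k[0,1]$ is the set of $u\in\mathrm{PC}[0,1]$ all of whose jumps lie in the finite set $X^k$. $I_j$ are the successive intervals into which $X^k$, together with $0$ and $1$, partitions $[0,1]$; in the mesh size, the points $x_i$ are listed in increasing order and $0,1$ are included, so $\eta=\max_j|I_j|$. Integral sampling: $S_kf(j)=\frac1{|I_j|}\int_{I_j}f\,d\lambda$. Point sampling at midpoints: $S_kf(j)=f(m_j)$ with $m_j$ the midpoint of $I_j$. The discrete Potts functional is $P^k_\gamma(u)=\gamma J(u)+\|u-f^k\|_1$ for $u\in\mathrm{PC}^k[0,1]$ (and $+\infty$ for other $u \in L^1[0,1]$). To define $K*g$, $g$ is extended to the left of $0$ and to the right of $1$ by its value on the leftmost and rightmost interval, respectively. The support size $\kappa>0$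 of $K$ is the half-width of its support, i.e. $\operatorname{supp}K\subset[-\kappa,\kappa]$. $h_{\min}$ and $h_{\max}$ denote the minimal and maximal jump height (absolute value of the jump) of $g$, and $l_{\min}$ the minimal length of the intervals into which the jump locations of $g$ partition $[0,1]$ (boundary intervals included). In the representations of $g$ and $g^k$, the $t_i$ are the jump locations of $g$, with the endpoints $0$ and $1$ of $[0,1]$ kept unchanged. If $g$ is constant, $h_{\min},h_{\max},l_{\min}$ are not defined, and the statement is understood with the constraints void, with $\gamma>0$ arbitrary. *)

(* Defs.v *)
From HB Require Import structures.
From mathcomp Require Import all_boot all_order all_algebra finmap.
From mathcomp Require Import all_classical all_reals all_analysis.

Set Implicit Arguments.
Unset Strict Implicit.
Unset Printing Implicit Defensive.
Import Order.TTheory GRing.Theory Num.Theory.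
Import numFieldNormedType.Exports.

Local Open Scope classical_set_scope.
Local Open Scope ring_scope.

Inductive sampling := IntegralSampling | MidpointSampling.

Section Potts.
Context {R : realType}.
Local Notation mu := (@lebesgue_measure R).
Implicit Types (t a s : nat -> R) (u v : R -> R) (X : {fset R}).

Definition I01 : set R := `[0, 1].

(* Elements of L^1[0,1] are represented by functions on R; their values outside
   [0,1] are irrelevant, and equality in L^1[0,1] is ae_eq mu I01. *)
Definition L1 : set (R -> R) :=
  [set u | mu.-integrable I01 (EFin \o u)].

Definition L1dist u v : \bar R :=
  (\int[mu]_(x in I01) `|u x - v x|%:E)%E.

(* N is the number of intervals, with endpoints t 0, ..., t N and values
   a 0, ..., a N.-1; the other values of t and a are irrelevant. *)
Definition step_fun (N : nat) t a : R -> R :=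
  fun x => \sum_(i < N) a i * \1_`]t i, t i.+1[%classic x.

Definition partition01 (N : nat) t : Prop :=
  [/\ t 0%N = 0, t N = 1 & forall i, (i < N)%N -> t i < t i.+1].

Definition PC : set (R -> R) :=
  [set u | L1 u /\ exists N t a,
     partition01 N t /\ ae_eq mu I01 u (step_fun N t a)].

(* Depends only on the a.e. class of u on [0,1]; e is arbitrarily small, so the
   two intervals may be taken inside (0,1). *)
Definition jumps u : set R :=
  [set x | 0 < x < 1 /\ exists a b e : R, [/\ a != b, 0 < e,
     ae_eq mu `]x - e, x[%classic u (cst a) & ae_eq mu `]x, x + e[%classic u (cst b)]].

Definition J u : \bar R := counting (jumps u).

Definition PCk X : set (R -> R) := [set u | PC u /\ jumps u `<=` [set` X]].

Definition nodes X : seq R := sort <=%O (enum_fset (0 |` (1 |` X))%fset).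
Definition node X (j : nat) : R := nth 0 (nodes X) j.
(* The intervals I_j are ]node X j, node X j.+1[ for j < nint X. *)
Definition nint X : nat := (size (nodes X)).-1.

Definition mesh X : R :=
  \big[Num.max/0]_(j < nint X) (node X j.+1 - node X j).

Definition sample (m : sampling) X (f : R -> R) (j : nat) : R :=
  match m with
  | IntegralSampling =>
      (node X j.+1 - node X j)^-1 *
      \int[mu]_(x in `]node X j, node X j.+1[) f x
  | MidpointSampling => f ((node X j + node X j.+1) / 2)
  end.

Definition data (m : sampling) X (f : R -> R) : R -> R :=
  step_fun (nint X) (node X) (sample m X f).

Definition potts_energy (gamma : R) (f : R -> R) u : \bar R :=
  (gamma%:E * J u + L1dist u f)%E.

Definition potts (gamma : R) X (f : R -> R) u : \bar R :=
  if `[< PCk X u >] then potts_energy gamma f u else +oo%E.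

Definition is_minimizer (F : (R -> R) -> \bar R) u : Prop :=
  L1 u /\ forall v, L1 v -> (F u <= F v)%E.

Definition is_kernel (K : R -> R) (kappa : R) : Prop :=
  [/\ measurable_fun setT K,
      (forall x, K (- x) = K x),
      (forall x, 0 <= K x) /\ (\forall x \near (0 : R), 0 < K x),
      closure [set x | K x != 0] `<=` `[- kappa, kappa]
    & (\int[mu]_x (K x)%:E = 1)%E].

(* In what follows n is the number of jumps of g, so that
   g = step_fun n.+1 t a. *)
Definition jump_repr (n : nat) t a : Prop :=
  partition01 n.+1 t /\ forall i, (i < n)%N -> a i != a i.+1.

Definition extend01 (n : nat) t a : R -> R := fun x =>
  if x <= 0 then a 0%N else if 1 <= x then a n else step_fun n.+1 t a x.

Definition convolution (K g : R -> R) : R -> R :=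
  fun x => \int[mu]_y (K (x - y) * g y).

(* hmin and hmax are only meaningful for n > 0.  The default value of hmin is its
   first term, and all interval lengths are at most 1, so that neither default
   affects the minimum. *)
Definition hmin (n : nat) a : R :=
  \big[Num.min/`|a 1%N - a 0%N|]_(i < n) `|a i.+1 - a i|.
Definition hmax (n : nat) a : R :=
  \big[Num.max/0]_(i < n) `|a i.+1 - a i|.
Definition lmin (n : nat) t : R :=
  \big[Num.min/1]_(i < n.+1) (t i.+1 - t i).

Definition nearest X (x y : R) : Prop :=
  y \in X /\ forall z, z \in X -> `|y - x| <= `|z - x|.

Definition discretization X (n : nat) t s : Prop :=
  [/\ s 0%N = 0, s n.+1 = 1 &
      forall i, (0 < i <= n)%N -> nearest X (t i) (s i)].

Definition in01 X : Prop := forall x, x \in X -> 0 <= x <= 1.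

Definition mesh_condition (kappa : R) (n : nat) t a X : Prop :=
  kappa + mesh X <= hmin n a * lmin n t / (2 * (8 * hmax n a + hmin n a)).

Definition gamma_condition (gamma kappa : R) (n : nat) t a X : Prop :=
  2 * (kappa + mesh X) * hmax n a <= gamma <=
    2^-1 * hmin n a * lmin n t - (hmin n a + 6 * hmax n a) * (kappa + mesh X).

End Potts.

(* Main.v *)
Require Import Defs.
From HB Require Import structures.
From mathcomp Require Import all_boot all_order all_algebra finmap.
From mathcomp Require Import all_classical all_reals all_analysis measurable_realfun.
From mathcomp Require Import lra.
Set Implicit Arguments.
Unset Strict Implicit.
Unset Printing Implicit Defensive.
Import Order.TTheory GRing.Theory Num.Theory.
Import numFieldNormedType.Exports.
Local Open Scope classical_set_scope.
Local Open Scope ring_scope.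

(** On [0,1] the data are f^k = a_0 + sum_i (a_{i+1} - a_i) theta_i, where
    theta_i is the sampled convolution of K with the Heaviside function jumping
    at t_{i+1}; writing d for the kernel half-width plus the mesh size, theta_i
    is 0 left of t_{i+1} - d and 1 right of t_{i+1} + d, and by symmetry of K it
    is below (above) 1/2 exactly on the sampling intervals whose midpoint lies
    left (right) of t_{i+1}.

    Cut [0,1] at the midpoints between consecutive jumps of g, so that each
    window sees one jump, from A to B, with plateaus much longer than 2d.  In a
    window every candidate u pays at least gamma + int |B - A| min(theta, 1 - theta):
    with no jump it misses a plateau, with two jumps it pays gamma once too often,
    and with one jump the plateaus force the values A and B.  Equality then means
    that theta <= 1/2 before the jump of u and theta >= 1/2 after it, i.e. that the
    jump of u is a point of X^k nearest to that of g.  Summing over the windows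
    identifies the minimum and all the minimizers. *)

(** * Integrals on the real line and the kernel profile *)

(** Write h, H for [hmin], [hmax] and l for [lmin]. In a window with jump height h_k the cost int
    h_k min(theta, 1 - theta) is at most d h_k, because theta leaves {0, 1} on a length of at most
    2d. Hence gamma >= 2dH makes a second jump strictly too expensive. A constant on the window is
    at distance at least h_k (l/2 - d), and gamma <= hl/2 - (h + 6H)d makes this strictly more than
    one jump plus its cost. The mesh condition says exactly that 2dH <= hl/2 - (h + 6H)d; as h <= H
    it also gives 18d <= l. The delicate competitor has one jump but values other than A and B: in
    the transition zone of width 2d a wrong value can be an advantage, so that gain has to be
    bounded by the loss on the plateaus, wherever the jump lies. Strictness in all the other cases
    is what yields all minimizers and not merely the minimum. A constant g has no jump to put a
    window around and is treated separately. *)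

Section Lebesgue_real_line.
Context {R : realType}.
Local Notation mu := (@lebesgue_measure R).
Implicit Types (f g : R -> R) (c : R).

Lemma integrable_EFinZl (D : set R) c f : measurable D ->
  mu.-integrable D (EFin \o f) -> mu.-integrable D (EFin \o (fun x => c * f x)).
Proof. by move=> mD If; exact: (integrableZl _ c If). Qed.

Lemma integrable_EFinD (D : set R) f g : measurable D ->
  mu.-integrable D (EFin \o f) -> mu.-integrable D (EFin \o g) ->
  mu.-integrable D (EFin \o (fun x => f x + g x)).
Proof. by move=> mD If Ig; exact: (integrableD _ If Ig). Qed.

Lemma integrable_EFinB (D : set R) f g : measurable D ->
  mu.-integrable D (EFin \o f) -> mu.-integrable D (EFin \o g) ->
  mu.-integrable D (EFin \o (fun x => f x - g x)).
Proof. by move=> mD If Ig; exact: (integrableB _ If Ig). Qed.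

Lemma integrable_sum_EFin (D : set R) n (F : nat -> R -> R) : measurable D ->
  (forall i, (i < n)%N -> mu.-integrable D (EFin \o F i)) ->
  mu.-integrable D (EFin \o (fun x => \sum_(i < n) F i x)) /\
  \int[mu]_(x in D) (\sum_(i < n) F i x) = \sum_(i < n) \int[mu]_(x in D) F i x.
Proof.
move=> mD; elim: n => [|n IH] IF.
  under eq_fun do rewrite big_ord0; rewrite big_ord0; split.
    exact: integrable0.
  by rewrite Rintegral_cst // mul0r.
have [IS ES] := IH (fun i ni => IF i (ltnW ni)).
under eq_fun do rewrite big_ord_recr /=.
split; first by apply: integrable_EFinD => //; exact: IF.
by rewrite RintegralD ?ES ?big_ord_recr //; exact: IF.
Qed.

Let subl c : R -> measurableTypeR R := fun y => c - y.

Let measurable_subl c : measurable_fun setT (subl c).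
Proof. exact: measurable_funB. Qed.

(** By uniqueness of Lebesgue measure it suffices to compare lengths of half-open intervals. This
    invariance gives the substitution y -> c - y used for convolutions and for the symmetry of K. *)
Lemma pushforward_lebesgue_measure_subl c (A : set R) : measurable A ->
  pushforward mu (subl c) A = mu A.
Proof.
have mc := measurable_subl c.
move=> mA; apply/esym/lebesgue_measure_unique => //= _ [[a b]] _ <-.
rewrite /pushforward (_ : _ @^-1` _ = `[c - b, c - a[%classic); last first.
  by apply/seteqP; split => x /=; rewrite !in_itv /= /subl => /andP[? ?];
     apply/andP; split; lra.
rewrite !lebesgue_measure_itv /= !lte_fin.
have -> : (c - b < c - a) = (a < b) by apply/idP/idP => ?; lra.
by case: ifP => // _; rewrite -!EFinB; congr EFin; lra.
Qed.

Lemma integrable_subl c f : mu.-integrable setT (EFin \o f) ->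
  mu.-integrable setT (EFin \o (fun y => f (c - y))).
Proof.
move=> /integrableP[mf If]; apply/integrableP; split.
  by apply/measurable_EFinP; apply: measurableT_comp;
    [exact/measurable_EFinP|exact: measurable_subl].
apply: le_lt_trans If; rewrite le_eqVlt; apply/orP; left; apply/eqP.
have -> : (\int[mu]_x `|(EFin \o f) x| =
  \int[pushforward mu (subl c)]_x
     `|(EFin \o f) x|)%E.
  by apply: eq_measure_integral => //=;
    [exact: measurable_subl|move=> mc A mA _; exact/esym/pushforward_lebesgue_measure_subl].
rewrite ge0_integral_pushforward//.
- exact: measurable_subl.
- exact: measurableT_comp.
Qed.

Lemma Rintegral_subl c f : mu.-integrable setT (EFin \o f) ->
  \int[mu]_y f (c - y) = \int[mu]_y f y.
Proof.
move=> If; congr fine; apply/esym.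
have -> : (\int[mu]_x (f x)%:E =
  \int[pushforward mu (subl c)]_x
     (f x)%:E)%E.
  by apply: eq_measure_integral => //=;
    [exact: measurable_subl|move=> mc A mA _; exact/esym/pushforward_lebesgue_measure_subl].
rewrite integral_pushforward//.
- exact: measurable_subl.
- by case/integrableP: If.
- exact: integrable_subl If.
Qed.

Let leb : {measure set (measurableTypeR R) -> \bar R} := @lebesgue_measure R.

(* The filter instances of [\ae] are only found when the measure is packaged as
   a structure, which [leb] forces. *)
Definition aeR (P : R -> Prop) : Prop := \forall x \ae leb, P x.

Lemma aeR_all (P : R -> Prop) : (forall x, P x) -> aeR P.
Proof. by move=> HP; apply: aeW. Qed.

Lemma aeRS (P Q : R -> Prop) : (forall x, P x -> Q x) -> aeR P -> aeR Q.
Proof. exact: (@filterS _ (almost_everywhere leb)). Qed.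

Lemma aeRI (P Q : R -> Prop) : aeR P -> aeR Q -> aeR (fun x => P x /\ Q x).
Proof. exact: (@filterI _ (almost_everywhere leb)). Qed.

(** An interval of positive length is not contained in a null set. This turns almost-everywhere
    information into information at an actual point. *)
Lemma ae_eq_itvoo_exists (a b : R) (P : R -> Prop) : a < b ->
  aeR (fun x => a < x < b -> P x) -> exists2 x, a < x < b & P x.
Proof.
move=> ab [N [mN N0 sN]]; apply: contrapT => nP.
have : (mu `]a, b[%classic <= mu N)%E.
  apply: le_measure; rewrite ?inE //.
  move=> x /=; rewrite in_itv /= => xab; apply: sN => /= H.
  by apply: nP; exists x => //; exact: H.
rewrite N0 lebesgue_measure_itv /= lte_fin ab -EFinB lee_fin; lra.
Qed.

(** If the integral were 0, the nonnegative [f] would vanish almost everywhere, hence at some point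
    of the interval from [a] to [b]. *)
Lemma Rintegral_gt0 (D : set R) f (a b : R) : measurable D ->
  mu.-integrable D (EFin \o f) -> (forall x, D x -> 0 <= f x) -> a < b ->
  (forall x, a < x < b -> D x /\ 0 < f x) -> 0 < \int[mu]_(x in D) f x.
Proof.
move=> mD If f0 ab fab; rewrite lt_neqAle Rintegral_ge0 // andbT.
apply/eqP => E0.
have mf : measurable_fun D (EFin \o f) by case/integrableP: If.
have : ae_eq mu D (EFin \o f) (cst 0%E).
  apply/ae_eq_integral_abs => //.
  transitivity (\int[mu]_(x in D) (f x)%:E)%E.
    by apply: eq_integral => x; rewrite inE => Dx /=; rewrite ger0_norm ?f0.
  rewrite -[LHS]fineK; last exact: integrable_fin_num.
  by congr EFin; rewrite E0.
move=> H; have [|x xab] := @ae_eq_itvoo_exists a b (fun x => f x = 0) ab.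
  move: H; apply: filterS => x H /fab[Dx _]; by case: (H Dx).
by have [_] := fab _ xab => + fx0; rewrite fx0 ltxx.
Qed.

End Lebesgue_real_line.

Section Kernel.
Context {R : realType}.
Local Notation mu := (@lebesgue_measure R).
Variables (K : R -> R) (kappa : R).
Hypothesis kerK : is_kernel K kappa.

Let K_ge0 x : 0 <= K x. Proof. by case: kerK => _ _ [] . Qed.

Lemma kernel_integrable : mu.-integrable setT (EFin \o K).
Proof.
case: kerK => mK _ _ _ IK; apply/integrableP; split.
  exact/measurable_EFinP.
suff -> : (\int[mu]_x `|(EFin \o K) x| = 1)%E by rewrite ltry.
by rewrite -IK; apply: eq_integral => x _ /=; rewrite ger0_norm.
Qed.

Lemma kernel_integrableS (D : set R) : measurable D ->
  mu.-integrable D (EFin \o K).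
Proof. by move=> mD; apply: integrableS kernel_integrable. Qed.

(** The distribution function of the kernel: [profile (x - t)] is the value at x of K convolved with
    the Heaviside function jumping at t. *)
Definition profile (z : R) : R := \int[mu]_(x in `]-oo, z[) K x.

Lemma profile_sub (y z : R) : y <= z ->
  profile z - profile y = \int[mu]_(x in `[y, z[) K x.
Proof.
move=> yz; rewrite /profile (@itv_bndbnd_setU _ _ _ (BLeft y)) //.
have dI : [disjoint `]-oo, y[%classic & `[y, z[%classic].
  apply/disj_setPS => x [] /=; rewrite !in_itv /= => h /andP[h' _].
  by move: h'; rewrite leNgt h.
have IU : mu.-integrable (`]-oo, y[ `|` `[y, z[) (EFin \o K).
  by apply: kernel_integrableS; exact: measurableU.
by rewrite (Rintegral_setU _ _ IU dI) // addrAC subrr add0r.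
Qed.

(** By symmetry of K the mass left of [- z] equals the mass right of [z], and the total mass is
    1. *)
Lemma profile_sym (z : R) : profile z + profile (- z) = 1.
Proof.
have -> : profile (- z) = \int[mu]_(x in `[z, +oo[) K x.
  rewrite -Rintegral_itv_obnd_cbnd; last exact: kernel_integrableS.
  rewrite /profile (Rintegral_mkcond mu `]-oo, (- z)[%classic)
    (Rintegral_mkcond mu `]z, +oo[%classic).
  have IP : mu.-integrable setT (EFin \o (K \_ `]-oo, (- z)[%classic)).
    rewrite -restrict_EFin; apply: (iffLR (integrable_mkcond _ _)) => //.
    exact: kernel_integrableS.
  rewrite -(Rintegral_subl 0 IP).
  apply: eq_Rintegral => x _; rewrite /patch sub0r !mem_setE !in_itv /= ltrN2 andbT.
  by case: ifP => // _; case: kerK => _ ->.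
have dI : [disjoint `]-oo, z[%classic & `[z, +oo[%classic].
  apply/disj_setPS => x [] /=; rewrite !in_itv /= => h /andP[h' _].
  by move: h'; rewrite leNgt h.
have IU : mu.-integrable (`]-oo, z[ `|` `[z, +oo[) (EFin \o K).
  by apply: kernel_integrableS; exact: measurableU.
rewrite /profile -(Rintegral_setU _ _ IU dI) // -itv_bndbnd_setU // set_itvNyy.
by rewrite /Rintegral; case: kerK => _ _ _ _ ->.
Qed.

Lemma profile_homo : {homo profile : y z / y <= z}.
Proof.
move=> y z yz; rewrite -subr_ge0 profile_sub //.
by apply: Rintegral_ge0.
Qed.

Lemma profile0 (z : R) : z <= - kappa -> profile z = 0.
Proof.
move=> zk; rewrite /profile (@eq_Rintegral _ _ _ _ _ (cst 0)).
  by rewrite Rintegral_cst // mul0r.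
move=> x; rewrite inE /= in_itv /= => xz; apply/eqP/negPn/negP => Kx.
have cKx : closure [set x | K x != 0] x by exact: subset_closure.
case: kerK => _ _ _ /(_ x cKx) + _.
by rewrite /= in_itv /= => /andP[]; lra.
Qed.

(** By [profile_sym] the claim is that K has positive mass on [[- z, z[]; this is where positivity
    near the origin enters. *)
Lemma profile_gt (z : R) : 0 < z -> 2^-1 < profile z.
Proof.
move=> z0; suff : 0 < profile z - profile (- z).
  by have := profile_sym z; lra.
rewrite profile_sub; last lra.
case: kerK => _ _ [_ /nbhs_ballP[e /= e0 He]] _ _.
(* The minimum keeps the interval both inside [[- z, z[] and inside the ball of radius [e] where K
   is positive. *)
apply: (@Rintegral_gt0 _ _ _ (- Num.min e z) (Num.min e z)) => //.
- exact: kernel_integrableS.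
- by rewrite -subr_gt0 opprK; apply: addr_gt0; rewrite lt_min e0 z0.
- move=> x /andP[x1 x2]; move: x2; rewrite lt_min => /andP[x2 x3].
  move: x1; rewrite ltrNl lt_min => /andP[x1 x4].
  split; first by rewrite /= in_itv /=; apply/andP; split; lra.
  by apply: He; rewrite /ball /= sub0r normrN ltr_norml; apply/andP; split; lra.
Qed.

End Kernel.

(** * Sampling a symmetric profile *)

Section Sampling.
Context {R : realType}.
Local Notation mu := (@lebesgue_measure R).
Implicit Types (f F : R -> R) (l r t : R).

(** Sampling on an arbitrary interval: the arguments below reflect intervals about t, and a mirror
    image is in general not an interval of the discretization. *)
Definition sample_itv (m : sampling) f l r : R :=
  match m with
  | IntegralSampling => (r - l)^-1 * \int[mu]_(x in `]l, r[) f x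
  | MidpointSampling => f ((l + r) / 2)
  end.

Lemma sampleE m (X : {fset R}) f j :
  sample m X f j = sample_itv m f (node X j) (node X j.+1).
Proof. by case: m. Qed.

Lemma bounded_integrable_itv f (M : R) (l r : R) b0 b1 :
  measurable_fun setT f -> (forall x, `|f x| <= M) ->
  mu.-integrable [set` Interval (BSide b0 l) (BSide b1 r)] (EFin \o f).
Proof.
move=> mf fM; apply: measurable_bounded_integrable => //.
- by rewrite /= lebesgue_measure_itv /=; case: ifP => _; rewrite -?EFinB ltry.
- exact: measurable_funS mf.
- exists M; split; first exact: num_real.
  by move=> y My x _; rewrite /= (le_trans (fM x)) // ltW.
Qed.

Lemma cst_integrable_itv (c l r : R) b0 b1 :
  mu.-integrable [set` Interval (BSide b0 l) (BSide b1 r)] (EFin \o cst c).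
Proof. exact: (@bounded_integrable_itv (cst c) `|c|). Qed.

Lemma Rintegral_itvoo_cst l r (c : R) : l <= r ->
  \int[mu]_(x in `]l, r[) c = c * (r - l).
Proof.
move=> lr; rewrite Rintegral_cst //= lebesgue_measure_itv /= lte_fin.
move: lr; rewrite le_eqVlt => /predU1P[->|lr]; first by rewrite ltxx subrr.
by rewrite lr.
Qed.

Lemma Rintegral_itvoo_refl f l r t :
  mu.-integrable `]l, r[ (EFin \o f) ->
  \int[mu]_(x in `]2 * t - r, 2 * t - l[) f (2 * t - x) = \int[mu]_(x in `]l, r[) f x.
Proof.
move=> If; rewrite (Rintegral_mkcond mu `]l, r[%classic)
   (Rintegral_mkcond mu `]2 * t - r, 2 * t - l[%classic).
have IP : mu.-integrable setT (EFin \o (f \_ `]l, r[%classic)).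
  by rewrite -restrict_EFin; apply: (iffLR (integrable_mkcond _ _)).
rewrite -[RHS](Rintegral_subl (2 * t) IP); apply: eq_Rintegral => x _.
rewrite /patch !mem_setE !in_itv /=.
have -> : (2 * t - r < x < 2 * t - l) = (l < 2 * t - x < r).
  by apply/andP/andP => -[? ?]; split; lra.
by case: ifP.
Qed.

(** The properties of the smoothed Heaviside function on which the rest relies. The strict
    inequality lets a sample reveal on which side of t the midpoint of its interval lies. *)
Definition is_profile (Phi : R -> R) (kappa : R) : Prop :=
  [/\ {homo Phi : y z / y <= z}, (forall z, Phi z + Phi (- z) = 1),
      (forall z, z <= - kappa -> Phi z = 0) & (forall z, 0 < z -> 2^-1 < Phi z)].

Section profile.
Variables (Phi : R -> R) (kappa : R).
Hypothesis Phi_profile : is_profile Phi kappa.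

Let Phi_homo : {homo Phi : y z / y <= z}. Proof. by case: Phi_profile. Qed.
Let Phi_sym z : Phi z + Phi (- z) = 1. Proof. by case: Phi_profile. Qed.
Let Phi_0 z : z <= - kappa -> Phi z = 0. Proof. by case: Phi_profile => _ _ /(_ z). Qed.
Let Phi_gt z : 0 < z -> 2^-1 < Phi z. Proof. by case: Phi_profile => _ _ _ /(_ z). Qed.

Lemma profile_ge0 z : 0 <= Phi z.
Proof.
rewrite -(@Phi_0 (Num.min z (- kappa))) ?ge_min ?lexx ?orbT //.
by apply: Phi_homo; rewrite ge_min lexx.
Qed.

Lemma profile_le1 z : Phi z <= 1.
Proof. by have := Phi_sym z; have := profile_ge0 (- z); lra. Qed.

Lemma measurable_profile : measurable_fun setT Phi.
Proof. by apply: nondecreasing_measurable => // x y; exact: Phi_homo. Qed.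

Variable t : R.
Let F x := Phi (x - t).

Lemma measurable_profile_shift : measurable_fun setT F.
Proof.
apply: (measurableT_comp measurable_profile).
exact: measurable_funB.
Qed.

Lemma profile_shift_le1 x : `|F x| <= 1.
Proof. by rewrite ger0_norm ?profile_ge0 // profile_le1. Qed.

Let FI l r b0 b1 :
  mu.-integrable [set` Interval (BSide b0 l) (BSide b1 r)] (EFin \o F).
Proof.
exact: (bounded_integrable_itv _ _ _ _ measurable_profile_shift profile_shift_le1).
Qed.

Let F_refl x : F (2 * t - x) = 1 - F x.
Proof.
rewrite /F; have := Phi_sym (x - t).
have -> : 2 * t - x - t = - (x - t) by lra.
lra.
Qed.

(** The graph of [F] is symmetric about the point (t, 1/2), and both samplings respect this. Each
    bound from above or on the right then follows from its mirror image. *)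
Lemma sample_refl m l r : l < r ->
  sample_itv m F (2 * t - r) (2 * t - l) = 1 - sample_itv m F l r.
Proof.
move=> lr; have d0 : r - l != 0 by rewrite subr_eq0 gt_eqF.
case: m => /=; last first.
  by rewrite -F_refl; congr F; lra.
rewrite -(@Rintegral_itvoo_refl F l r t) //.
have -> : 2 * t - l - (2 * t - r) = r - l by lra.
apply: (mulfI d0); rewrite mulrBr !mulVKf // mulr1.
under [in RHS]eq_Rintegral do rewrite F_refl.
rewrite RintegralB //=; first by rewrite Rintegral_itvoo_cst; lra.
exact: cst_integrable_itv.
Qed.

Lemma sample_ge0 m l r : l < r -> 0 <= sample_itv m F l r.
Proof.
move=> lr; case: m => /=; last exact: profile_ge0.
apply: mulr_ge0; first by rewrite invr_ge0; lra.
by apply: Rintegral_ge0 => x _; exact: profile_ge0.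
Qed.

Lemma sample_le1 m l r : l < r -> sample_itv m F l r <= 1.
Proof.
move=> lr; have := @sample_ge0 m (2 * t - r) (2 * t - l).
by rewrite sample_refl //; lra.
Qed.

Lemma sample_eq0 m l r : l < r -> r <= t - kappa -> sample_itv m F l r = 0.
Proof.
move=> lr rt; case: m => /=; last by rewrite /F Phi_0 //; lra.
rewrite (@eq_Rintegral _ _ _ _ _ (cst 0)); first by rewrite Rintegral_cst // mul0r mulr0.
move=> x; rewrite inE /= in_itv /= => /andP[_ xr].
by rewrite /F Phi_0 //; lra.
Qed.

Lemma sample_eq1 m l r : l < r -> t + kappa <= l -> sample_itv m F l r = 1.
Proof.
move=> lr rt; have := @sample_eq0 m (2 * t - r) (2 * t - l).
by rewrite sample_refl //; lra.
Qed.

(** For integral sampling, [G], which is F - 1/2, is odd about t and positive to its right. If t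
    lies inside the interval, the part from l to 2t - l is symmetric about t and integrates to 0;
    what remains lies to the right of t. *)
Lemma sample_gt m l r : l < r -> 2 * t < l + r -> 2^-1 < sample_itv m F l r.
Proof.
move=> lr trl; case: m => /=; last by apply: Phi_gt; lra.
have d0 : 0 < r - l by lra.
rewrite -(ltr_pM2l d0) mulVKf ?gt_eqF // mulrC -Rintegral_itvoo_cst; last lra.
pose G x := F x - 2^-1.
have IG a b b0 b1 : mu.-integrable [set` Interval (BSide b0 a) (BSide b1 b)] (EFin \o G).
  apply: (@bounded_integrable_itv _ 2).
    by apply: measurable_funB => //; exact: measurable_profile_shift.
  move=> x; have := profile_ge0 (x - t); have := profile_le1 (x - t).
  rewrite -/(F x) /G => ? ?.
  by rewrite ler_norml; apply/andP; split; lra.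
rewrite -subr_gt0 -RintegralB //; try exact: FI; try exact: cst_integrable_itv.
have Gpos a b : t <= a -> a < b -> 0 < \int[mu]_(x in `]a, b[) G x.
  move=> ta ab; apply: (@Rintegral_gt0 _ _ _ a b) => //.
    move=> x /=; rewrite in_itv /= => /andP[ax xb].
    by have := @Phi_gt (x - t) ltac:(lra); rewrite /G /F; lra.
  move=> x axb; rewrite /= in_itv /=; split => //.
  by have := @Phi_gt (x - t) ltac:(lra); rewrite /G /F; lra.
have [tl|lt] := leP t l; first exact: Gpos.
have G0 : \int[mu]_(x in `]l, 2 * t - l[) G x = 0.
  have := @Rintegral_itvoo_refl G l (2 * t - l) t (IG _ _ _ _).
  have -> : 2 * t - (2 * t - l) = l by lra.
  rewrite (@eq_Rintegral _ _ _ mu _ (fun x => - 1 * G x)); last first.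
    by move=> x _; rewrite /G F_refl; lra.
  by rewrite RintegralZl //; lra.
have := @Rintegral_itvB _ G (BRight l) (BLeft r) (2 * t - l) (IG _ _ _ _).
rewrite !bnd_simp -/(G _) => /(_ ltac:(lra) ltac:(lra)).
rewrite -Rintegral_itv_bndo_bndc ?G0 ?subr0; last exact: IG.
by move=> ->; apply: Gpos; lra.
Qed.

Lemma sample_lt m l r : l < r -> l + r < 2 * t -> sample_itv m F l r < 2^-1.
Proof.
move=> lr trl; have := @sample_gt m (2 * t - r) (2 * t - l).
by rewrite sample_refl //; lra.
Qed.

End profile.
End Sampling.

Lemma kernel_profile (R : realType) (K : R -> R) (kappa : R) :
  is_kernel K kappa -> is_profile (profile K) kappa.
Proof.
move=> kerK; split; [exact: profile_homo kerK|exact: profile_sym kerK|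
  exact: profile0 kerK|exact: profile_gt kerK].
Qed.

(** * Step functions *)

Section Jump_sums.
Context {R : realType}.
Local Notation mu := (@lebesgue_measure R).
Implicit Types (t a s F : nat -> R).

(* Writes a step function as its leftmost value plus its jumps weighted by F;
   with F i the Heaviside function at the i-th jump this is the function itself,
   and convolving or sampling acts on the weights F only. *)
Definition jump_sum (n : nat) a F : R :=
  a 0%N + \sum_(i < n) (a i.+1 - a i) * F i.

Lemma jump_sumS n a F :
  jump_sum n.+1 a F = jump_sum n a F + (a n.+1 - a n) * F n.
Proof. by rewrite /jump_sum big_ord_recr /= addrA. Qed.

Lemma jump_sum1 n a F : (forall i, (i < n)%N -> F i = 1) -> jump_sum n a F = a n.
Proof.
elim: n => [|n IH] F1; first by rewrite /jump_sum big_ord0 addr0.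
rewrite jump_sumS IH; last by move=> i ?; apply: F1; rewrite ltnS ltnW.
by rewrite F1 // mulr1 addrC subrK.
Qed.

(** The completed jumps telescope to [a k] and the jumps not yet begun vanish, so that only the k-th
    transition stays visible. *)
Lemma jump_sumE n a F k : (k < n)%N -> (forall i, (i < k)%N -> F i = 1) ->
  (forall i, (k < i < n)%N -> F i = 0) ->
  jump_sum n a F = a k + (a k.+1 - a k) * F k.
Proof.
elim: n => // n IH; rewrite ltnS leq_eqVlt => /predU1P[->|kn] F1 F0.
  by rewrite jump_sumS jump_sum1.
have -> : jump_sum n.+1 a F = jump_sum n a F.
  by rewrite jump_sumS F0 ?mulr0 ?addr0 // kn /=.
apply: IH => // i /andP[ki iN]; by apply: F0; rewrite ki ltnS ltnW.
Qed.

Lemma jump_sum01 n a F k : (k <= n)%N -> (forall i, (i < k)%N -> F i = 1) ->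
  (forall i, (k <= i < n)%N -> F i = 0) -> jump_sum n a F = a k.
Proof.
rewrite leq_eqVlt => /predU1P[->|kn] F1 F0; first exact: jump_sum1.
rewrite (@jump_sumE _ _ _ k) //; first by rewrite F0 ?mulr0 ?addr0 // leqnn.
by move=> i /andP[ki iN]; apply: F0; rewrite ltnW.
Qed.

Lemma eq_jump_sum n a F G : (forall i, (i < n)%N -> F i = G i) ->
  jump_sum n a F = jump_sum n a G.
Proof.
by move=> FG; rewrite /jump_sum; congr +%R; apply: eq_bigr => i _; rewrite FG.
Qed.

Lemma jump_sum_integrable (D : set R) n a (F : nat -> R -> R) :
  measurable D -> mu.-integrable D (EFin \o cst (a 0%N)) ->
  (forall i, (i < n)%N -> mu.-integrable D (EFin \o F i)) ->
  mu.-integrable D (EFin \o (fun x => jump_sum n a (F^~ x))) /\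
  \int[mu]_(x in D) jump_sum n a (F^~ x) =
  \int[mu]_(x in D) a 0%N +
    \sum_(i < n) (a i.+1 - a i) * \int[mu]_(x in D) F i x.
Proof.
move=> mD I0 IF.
have IZ i : (i < n)%N ->
    mu.-integrable D (EFin \o (fun x => (a i.+1 - a i) * F i x)).
  by move=> iN; apply: integrable_EFinZl => //; exact: IF.
have [IS ES] := integrable_sum_EFin mD IZ.
split; first exact: integrable_EFinD.
rewrite RintegralD // ES; congr +%R; apply: eq_bigr => i _.
by rewrite RintegralZl //; exact: IF.
Qed.

(** Both samplings are linear and reproduce constants. *)
Lemma sample_jump_sum m n a (F : nat -> R -> R) (l r : R) : l < r ->
  (forall i, (i < n)%N -> mu.-integrable `]l, r[ (EFin \o F i)) ->
  sample_itv m (fun x => jump_sum n a (F^~ x)) l r =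
  jump_sum n a (fun i => sample_itv m (F i) l r).
Proof.
case: m => //= lr IF.
have [||_ ->] := @jump_sum_integrable `]l, r[%classic n a F _ _ IF => //.
  exact: cst_integrable_itv.
rewrite Rintegral_itvoo_cst ?ltW // /jump_sum mulrDr mulrC mulfK ?gt_eqF ?subr_gt0 //.
congr +%R; rewrite mulr_sumr; apply: eq_bigr => i _.
by rewrite mulrCA.
Qed.

End Jump_sums.

(** * Partitions of [0,1] and step functions away from their breakpoints *)

Section Partitions.
Context {R : realType}.
Local Notation mu := (@lebesgue_measure R).
Implicit Types (t a s : nat -> R).

Lemma partition_lt N t i j : partition01 N t -> (i < j <= N)%N -> t i < t j.
Proof.
move=> [_ _ tS]; elim: j => // j IH /andP[]; rewrite ltnS leq_eqVlt.
move=> /predU1P[->|ij] jN; first exact: tS.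
by apply: lt_trans (tS _ jN); apply: IH; rewrite ij ltnW.
Qed.

Lemma partition_le N t i j : partition01 N t -> (i <= j <= N)%N -> t i <= t j.
Proof.
move=> pt /andP[]; rewrite leq_eqVlt => /predU1P[-> //|ij] jN.
by apply/ltW/(partition_lt pt); rewrite ij.
Qed.

Lemma partition_find N t x : partition01 N t -> 0 < x <= 1 ->
  exists2 k, (k < N)%N & t k < x <= t k.+1.
Proof.
move=> [t0 tN _] /andP[x0]; rewrite -tN; rewrite -t0 in x0.
elim: N {tN} => [|N IH]; first by move=> /(lt_le_trans x0); rewrite ltxx.
have [xN _|xN xN1] := leP x (t N); last by exists N; rewrite ?xN.
by have [k kN] := IH xN; exists k => //; rewrite ltnS ltnW.
Qed.

Lemma step_funE N t a x k : partition01 N t -> (k < N)%N -> t k < x < t k.+1 ->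
  step_fun N t a x = a k.
Proof.
move=> pt kN xk; rewrite /step_fun (bigD1 (Ordinal kN)) //= big1 => [|i ik].
  by rewrite addr0 indicE mem_setE in_itv /= xk mulr1.
rewrite indicE mem_setE in_itv /=.
suff -> : (t i < x < t i.+1) = false by rewrite mulr0.
apply/negP => /andP[x1 x2]; move/andP: xk => [x3 x4].
have : (i != k :> nat) by apply: contra ik => /eqP ?; apply/eqP/val_inj.
rewrite neq_ltn => /orP[] H.
  have := @partition_le _ _ i.+1 k pt; rewrite H (ltnW kN) => /(_ isT).
  by move=> ?; lra.
have := @partition_le _ _ k.+1 i pt; rewrite H (ltnW (ltn_ord i)) => /(_ isT).
by move=> ?; lra.
Qed.

Lemma measurable_step_fun N t a : measurable_fun setT (step_fun N t a).
Proof.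
by apply: measurable_sum => i; exact: measurable_funM.
Qed.

Lemma step_fun_bounded N t a x : `|step_fun N t a x| <= \sum_(i < N) `|a i|.
Proof.
apply: le_trans (ler_norm_sum _ _ _) _; apply: ler_sum => i _.
rewrite normrM indicE; case: (_ \in _); first by rewrite normr1 mulr1.
by rewrite normr0 mulr0.
Qed.

Lemma step_fun_integrable N t a l r b0 b1 :
  mu.-integrable [set` Interval (BSide b0 l) (BSide b1 r)] (EFin \o step_fun N t a).
Proof.
exact: (bounded_integrable_itv _ _ _ _ (measurable_step_fun _ _ _)
          (step_fun_bounded _ _ _)).
Qed.

(** A sequence is a null set. This discards the breakpoints, at which [step_fun] takes the value 0
    because its intervals are open. *)
Lemma ae_neq_seq t : aeR (fun x => forall i, x != t i).
Proof.
apply: ae_foralln => i; exists [set t i]; split => //.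
  exact: lebesgue_measure_set1.
by move=> x /= /negP/negPn/eqP.
Qed.

Lemma step_fun_jump_sum n t a (x : R) : partition01 n.+1 t -> 0 < x <= 1 ->
  (forall i, x != t i) ->
  step_fun n.+1 t a x = jump_sum n a (fun i => (t i.+1 < x)%R%:R).
Proof.
move=> pt x01 xt; have [k kN xk] := partition_find pt x01.
have xk' : t k < x < t k.+1.
  by move: xk; rewrite [x <= _]le_eqVlt (negbTE (xt _)).
rewrite (step_funE _ pt kN xk') (@jump_sum01 _ _ _ _ k) //.
  move=> i ik; have := @partition_le _ _ i.+1 k pt; rewrite ik (ltnW kN).
  by move/(_ isT) => tik; move/andP: xk => [/(le_lt_trans tik) ->].
move=> i /andP[ki iN]; have := @partition_le _ _ k.+1 i.+1 pt.
rewrite !ltnS ki (ltnW iN) => /(_ isT) tki; case/andP: xk => _ /le_trans /(_ tki).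
by rewrite leNgt => /negbTE ->.
Qed.

(** The constant extension suits the jump form on the whole line: left of 0 no jump has been passed,
    right of 1 all of them have. *)
Lemma extend01_jump_sum n t a (x : R) : partition01 n.+1 t -> (forall i, x != t i) ->
  extend01 n t a x = jump_sum n a (fun i => (t i.+1 < x)%R%:R).
Proof.
move=> pt xt; have [t0 t1 _] := pt; rewrite /extend01.
case: leP => x0.
  rewrite (@jump_sum01 _ _ _ _ 0) // => i /andP[_ iN].
  have := @partition_le _ _ 0 i.+1 pt; rewrite t0 ltnS (ltnW iN) => /(_ isT) ti.
  by rewrite ltNge (le_trans x0).
case: leP => x1; last by apply: step_fun_jump_sum => //; rewrite x0 ltW.
rewrite (@jump_sum01 _ _ _ _ n) //.
  move=> i iN; have := @partition_lt _ _ i.+1 n.+1 pt; rewrite t1 ltnS iN leqnn.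
  by move/(_ isT) => /lt_le_trans ->.
by move=> i /andP[/leq_ltn_trans H /H]; rewrite ltnn.
Qed.

Lemma measurable_extend01 n t a : measurable_fun setT (extend01 n t a).
Proof.
apply: measurable_fun_ifT => //; first exact: measurable_fun_ler.
apply: measurable_fun_ifT => //; first exact: measurable_fun_ler.
exact: measurable_step_fun.
Qed.

End Partitions.

(** * Convolution of a step function with the kernel *)

Section Convolution.
Context {R : realType}.
Local Notation mu := (@lebesgue_measure R).
Variables (K : R -> R) (kappa : R).
Hypothesis kerK : is_kernel K kappa.

(** After the substitution y -> x - y the i-th jump contributes the mass of K left of [x - t i.+1].
    Replacing g by its jump form alters the integrand at breakpoints only. *)
Lemma convolution_jump_sum n (t a : nat -> R) x : partition01 n.+1 t ->
  convolution K (extend01 n t a) x =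
  jump_sum n a (fun i => profile K (x - t i.+1)).
Proof.
move=> pt; rewrite /convolution.
pose F i z := K z * (t i.+1 < x - z)%R%:R.
have FE i : F i = K \_ `]-oo, x - t i.+1[%classic.
  apply/funext => z; rewrite /F /patch mem_setE in_itv /=.
  have -> : (t i.+1 < x - z) = (z < x - t i.+1) by apply/idP/idP => ?; lra.
  by case: ifP; rewrite ?mulr1 ?mulr0.
have IF i : mu.-integrable setT (EFin \o F i).
  rewrite FE -restrict_EFin; apply: (iffLR (integrable_mkcond _ _)) => //.
  exact: kernel_integrableS kerK _ _.
have EF i : \int[mu]_z F i z = profile K (x - t i.+1).
  by rewrite FE /profile [RHS](Rintegral_mkcond mu).
pose h z := K z * jump_sum n a (fun i => (t i.+1 < x - z)%R%:R).
have hE z : h z = a 0%N * K z + \sum_(i < n) (a i.+1 - a i) * F i z.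
  rewrite /h /jump_sum mulrDr mulrC mulr_sumr; congr +%R.
  by apply: eq_bigr => i _; rewrite mulrCA.
have I0 : mu.-integrable setT (EFin \o (fun z => a 0%N * K z)).
  by apply: integrable_EFinZl =>//; exact: kernel_integrable kerK.
have IZ i : (i < n)%N ->
    mu.-integrable setT (EFin \o (fun z => (a i.+1 - a i) * F i z)).
  by move=> _; apply: integrable_EFinZl => //; exact: IF.
have [IS ES] := integrable_sum_EFin measurableT IZ.
have [Ih Eh] : mu.-integrable setT (EFin \o h) /\
   \int[mu]_z h z = a 0%N + \sum_(i < n) (a i.+1 - a i) * \int[mu]_z F i z.
  have -> : h = fun z => a 0%N * K z + \sum_(i < n) (a i.+1 - a i) * F i z.
    exact/funext.
  split; first exact: integrable_EFinD.
  rewrite RintegralD // ES RintegralZl //; last exact: kernel_integrable kerK.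
  rewrite {1}/Rintegral; case: kerK => _ _ _ _ ->; rewrite mulr1; congr +%R.
  by apply: eq_bigr => i _; rewrite RintegralZl.
transitivity (\int[mu]_y h (x - y)).
  have mK : measurable_fun setT K by case: kerK.
  have mxK : measurable_fun setT (fun y : R => K (x - y)).
    by apply: (measurableT_comp mK); exact: measurable_funB.
  congr fine; apply: ae_eq_integral => //.
  - apply/measurable_EFinP; apply: measurable_funM => //.
    exact: measurable_extend01.
  - have /integrableP[] := integrable_subl x Ih.
    by [].
  apply: aeRS (ae_neq_seq t) => y yt _ /=.
  rewrite /h extend01_jump_sum //.
  by under [in RHS]eq_jump_sum => i _ do rewrite subKr.
rewrite Rintegral_subl // Eh /jump_sum; congr +%R.
by apply: eq_bigr => i _; rewrite EF.
Qed.

End Convolution.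

(** * Discretization nodes *)

Section Nodes.
Context {R : realType}.
Implicit Types (X : {fset R}).

Lemma mem_nodes X x : (x \in nodes X) = [|| x == 0, x == 1 | x \in X].
Proof. by rewrite mem_sort !inE. Qed.

Lemma nodes_sorted X : sorted <%O (nodes X).
Proof. by rewrite sort_lt_sorted fset_uniq. Qed.

Lemma nodes_ltn X i j : (i < j < size (nodes X))%N -> node X i < node X j.
Proof.
move=> /andP[ij js]; apply: (sorted_ltn_nth lt_trans) => //; first exact: nodes_sorted.
by rewrite inE (ltn_trans ij).
Qed.

Lemma nodes_size X : (1 < size (nodes X))%N.
Proof.
have : {subset [:: 0; 1 : R] <= nodes X}.
  by move=> x; rewrite mem_nodes !inE => /orP[] ->; rewrite ?orbT.
by apply: uniq_leq_size; rewrite /= inE eq_sym oner_neq0.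
Qed.

Lemma nodeP X x : reflect (exists2 j, (j <= nint X)%N & x = node X j)
  [|| x == 0, x == 1 | x \in X].
Proof.
have s1 := ltnW (nodes_size X).
rewrite -mem_nodes; apply: (iffP idP) => [|[j jn ->]].
  move=> /(nthP 0)[j js <-]; exists j => //.
  by rewrite /nint -ltnS prednK.
by apply: mem_nth; rewrite -(prednK s1) ltnS.
Qed.

Lemma nodes_partition X : in01 X -> partition01 (nint X) (node X).
Proof.
move=> X01; have s1 := ltnW (nodes_size X).
have n01 j : (j <= nint X)%N -> 0 <= node X j <= 1.
  move=> jn; have /or3P[/eqP->|/eqP->|/X01 //] :
      [|| node X j == 0, node X j == 1 | node X j \in X].
    by apply/nodeP; exists j.
  - by rewrite lexx ler01.
  - by rewrite ler01 lexx.
have nle i j : (i <= j <= nint X)%N -> node X i <= node X j.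
  move=> /andP[]; rewrite leq_eqVlt => /predU1P[-> //|ij] jn.
  by apply/ltW/nodes_ltn; rewrite ij -(prednK s1) ltnS.
split.
- have [|j jn e] := elimT (nodeP X 0); first by rewrite eqxx.
  apply/eqP; rewrite eq_le; have /andP[-> _] := n01 0%N isT.
  by rewrite andbT [leRHS]e nle.
- have [|j jn e] := elimT (nodeP X 1); first by rewrite eqxx orbT.
  apply/eqP; rewrite eq_le; have /andP[_ ->] := n01 _ (leqnn (nint X)).
  by rewrite /= [leLHS]e nle // jn leqnn.
- by move=> i iN; apply: nodes_ltn; rewrite ltnSn -(prednK s1) ltnS.
Qed.

Lemma mesh_ge X j : (j < nint X)%N -> node X j.+1 - node X j <= mesh X.
Proof.
by move=> jn; exact: (le_bigmax_cond _ (fun j : 'I_(nint X) => node X j.+1 - node X j)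
   (j := Ordinal jn)).
Qed.

Lemma mesh_ge0 X : 0 <= mesh X.
Proof. exact: bigmax_ge_id. Qed.

Lemma dataE m X f j x : in01 X -> (j < nint X)%N -> node X j < x < node X j.+1 ->
  data m X f x = sample_itv m f (node X j) (node X j.+1).
Proof.
move=> X01 jn xj; rewrite /data (step_funE _ _ jn) ?sampleE //.
exact: nodes_partition.
Qed.

Lemma node_itv X x : in01 X -> 0 < x < 1 -> (forall i, x != node X i) ->
  exists2 j, (j < nint X)%N & node X j < x < node X j.+1.
Proof.
move=> X01 /andP[x0 x1] xn; have pX := nodes_partition X01.
have [|j jn xj] := partition_find pX (x := x); first by rewrite x0 ltW.
by exists j => //; move: xj; rewrite [x <= _]le_eqVlt (negbTE (xn _)).
Qed.

Variables (m : sampling) (X : {fset R}) (Phi : R -> R) (kappa : R).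
Hypothesis Phi_profile : is_profile Phi kappa.
Hypothesis X01 : in01 X.

Lemma data_jump_sum n (t a : nat -> R) x : 0 < x < 1 -> (forall i, x != node X i) ->
  data m X (fun y => jump_sum n a (fun i => Phi (y - t i.+1))) x =
  jump_sum n a (fun i => data m X (fun y => Phi (y - t i.+1)) x).
Proof.
move=> x01 xn; have [j jn xj] := node_itv X01 x01 xn.
have jj : node X j < node X j.+1 by case/andP: xj; exact: lt_trans.
rewrite (dataE _ _ X01 jn xj).
rewrite (@sample_jump_sum _ m n a (fun i y => Phi (y - t i.+1))) //.
  by apply: eq_jump_sum => i _; rewrite (dataE _ _ X01 jn xj).
move=> i _; apply: (@bounded_integrable_itv _ _ 1).
  exact: measurable_profile_shift Phi_profile _.
exact: profile_shift_le1 Phi_profile _.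
Qed.

Variable t : R.
Let theta := data m X (fun y => Phi (y - t)).

Lemma measurable_data f : measurable_fun setT (data m X f).
Proof. exact: measurable_step_fun. Qed.

Lemma theta01 x : 0 < x < 1 -> (forall i, x != node X i) -> 0 <= theta x <= 1.
Proof.
move=> x01 xn; have [j jn xj] := node_itv X01 x01 xn.
have jj : node X j < node X j.+1 by case/andP: xj; exact: lt_trans.
rewrite /theta (dataE _ _ X01 jn xj) (sample_ge0 Phi_profile) //.
by rewrite (sample_le1 Phi_profile).
Qed.

(** The sampling interval containing x is no longer than the mesh size, so it lies entirely left of
    [t - kappa], where the profile vanishes. *)
Lemma theta0 x : 0 < x < 1 -> (forall i, x != node X i) ->
  x <= t - (kappa + mesh X) -> theta x = 0.
Proof.
move=> x01 xn xt; have [j jn /[dup] xj /andP[x1 x2]] := node_itv X01 x01 xn.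
have := mesh_ge jn => ?.
by rewrite /theta (dataE _ _ X01 jn xj) (sample_eq0 Phi_profile); lra.
Qed.

Lemma theta1 x : 0 < x < 1 -> (forall i, x != node X i) ->
  t + (kappa + mesh X) <= x -> theta x = 1.
Proof.
move=> x01 xn xt; have [j jn /[dup] xj /andP[x1 x2]] := node_itv X01 x01 xn.
have := mesh_ge jn => ?.
by rewrite /theta (dataE _ _ X01 jn xj) (sample_eq1 Phi_profile); lra.
Qed.

(** The competitors include the endpoints 0 and 1, which bound sampling intervals even when they are
    not in X; [nearest] compares with X alone. For jumps of g, [nearest_nearest_node] passes from
    [nearest] to this notion. *)
Definition nearest_node s :=
  (exists2 j, (j <= nint X)%N & s = node X j) /\
  forall j, (j <= nint X)%N -> `|s - t| <= `|node X j - t|.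

(** A sampling interval left of s with value above 1/2 would have its midpoint right of t, and its
    left endpoint would then be closer to t than s. If the midpoint is t itself, the interval is its
    own mirror image and the value is exactly 1/2. *)
Lemma theta_left s x : nearest_node s -> 0 < x < 1 ->
  (forall i, x != node X i) -> x < s -> theta x <= 2^-1.
Proof.
move=> [[k kn sk] near_s] x01 xn xs.
have [j jn /[dup] xj /andP[x1 x2]] := node_itv X01 x01 xn.
have jk : (j < k)%N.
  rewrite ltnNge; apply/negP => kj; have pX := nodes_partition X01.
  have := @partition_le _ _ _ k j pX; rewrite kj (ltnW jn) => /(_ isT); lra.
have js : node X j.+1 <= s.
  by rewrite sk; apply: (partition_le (nodes_partition X01)); rewrite jk.
rewrite leNgt; apply/negP; rewrite /theta (dataE _ _ X01 jn xj) => th.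
have : 2 * t < node X j + node X j.+1.
  rewrite ltNge le_eqVlt; apply/negP => /predU1P[e|lt]; last first.
    by have := sample_lt Phi_profile m (lt_trans x1 x2) lt; lra.
  have := sample_refl Phi_profile t m (lt_trans x1 x2).
  have -> : 2 * t - node X j.+1 = node X j by lra.
  have -> : 2 * t - node X j = node X j.+1 by lra.
  lra.
have := near_s j (ltnW jn) => h1 h2.
have h3 : s - t <= `|s - t| by exact: ler_norm.
have [h4|h4] := leP (node X j) t.
  by have := @ler0_norm _ (node X j - t) ltac:(lra); lra.
by have := @gtr0_norm _ (node X j - t) ltac:(lra); lra.
Qed.

Lemma theta_right s x : nearest_node s -> 0 < x < 1 ->
  (forall i, x != node X i) -> s < x -> 2^-1 <= theta x.
Proof.
move=> [[k kn sk] near_s] x01 xn xs.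
have [j jn /[dup] xj /andP[x1 x2]] := node_itv X01 x01 xn.
have jk : (k <= j)%N.
  rewrite leqNgt; apply/negP => kj; have pX := nodes_partition X01.
  have := @partition_le _ _ _ j.+1 k pX; rewrite kj kn => /(_ isT); lra.
have js : s <= node X j.
  by rewrite sk; apply: (partition_le (nodes_partition X01)); rewrite jk ltnW.
rewrite leNgt; apply/negP; rewrite /theta (dataE _ _ X01 jn xj) => th.
have : node X j + node X j.+1 < 2 * t.
  rewrite ltNge le_eqVlt; apply/negP => /predU1P[e|lt]; last first.
    by have := sample_gt Phi_profile m (lt_trans x1 x2) lt; lra.
  have := sample_refl Phi_profile t m (lt_trans x1 x2).
  have -> : 2 * t - node X j.+1 = node X j by lra.
  have -> : 2 * t - node X j = node X j.+1 by lra.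
  lra.
have := near_s j.+1 jn => h1 h2.
have h3 : - (s - t) <= `|s - t| by rewrite -normrN; exact: ler_norm.
have [h4|h4] := leP (node X j.+1) t.
  by have := @ler0_norm _ (node X j.+1 - t) ltac:(lra); lra.
by have := @gtr0_norm _ (node X j.+1 - t) ltac:(lra); lra.
Qed.

(** The two sampling intervals adjacent to s decide: their values place t between their midpoints,
    that is, in the Voronoi cell of s among the nodes. *)
Lemma theta_nearest s p q : s \in X -> 0 < s < 1 -> p < s < q ->
  aeR (fun x => p < x < s -> theta x <= 2^-1) ->
  aeR (fun x => s < x < q -> 2^-1 <= theta x) -> nearest_node s.
Proof.
move=> sX s01 /andP[ps sq] left right; have pX := nodes_partition X01.
have [|k kn sk] := elimT (nodeP X s); first by rewrite sX !orbT.
have [n0 n1 _] := pX.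
have k0 : (0 < k)%N by rewrite lt0n; apply/eqP => k0; move: s01; rewrite sk k0 n0; lra.
have kN : (k < nint X)%N.
  by rewrite ltn_neqAle kn andbT; apply/eqP => k1; move: s01; rewrite sk k1 n1; lra.
(* From here on s is node [k.+1], with neighbours [k] and [k.+2]; both exist because s is
   interior. *)
case: k k0 kn kN sk => // k _ _ kN sk.
have pk := partition_lt pX; have pl := partition_le pX.
have l1 : node X k < s by rewrite sk; apply: pk; rewrite ltnSn ltnW.
have l2 : s < node X k.+2 by rewrite sk; apply: pk; rewrite ltnSn.
have L : node X k + s <= 2 * t.
  rewrite leNgt; apply/negP => H.
  have [||x /andP[x1 x2] [hx]] := @ae_eq_itvoo_exists _ (Num.max p (node X k)) s
      (fun x => theta x <= 2^-1); first by rewrite gt_max ps.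
    apply: aeRS left => x hx /andP[]; rewrite gt_max => /andP[? ?] ?.
    by apply: hx; apply/andP.
  move: x1; rewrite gt_max => /andP[x1 x3]; move: hx.
  rewrite /theta (@dataE _ _ _ k) ?x3 -?sk ?(ltnW kN) //.
  by have := sample_gt Phi_profile m l1 H; lra.
have U : 2 * t <= s + node X k.+2.
  rewrite leNgt; apply/negP => H.
  have [||x /andP[x1 x2] [hx]] := @ae_eq_itvoo_exists _ s (Num.min q (node X k.+2))
      (fun x => 2^-1 <= theta x); first by rewrite lt_min sq.
    apply: aeRS right => x hx /andP[?]; rewrite lt_min => /andP[? ?].
    by apply: hx; apply/andP.
  move: x2; rewrite lt_min => /andP[x2 x3]; move: hx.
  rewrite /theta (@dataE _ _ _ k.+1) ?x3 -?sk ?x1 //.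
  by have := sample_lt Phi_profile m l2 H; lra.
split; first by exists k.+1 => //; exact: ltnW.
move=> j jn; have [jk|jk|->] := ltngtP j k.+1; last by rewrite sk.
- have := @partition_le _ _ _ j k pX; rewrite -ltnS jk (ltnW (ltnW kN)) => /(_ isT) h.
  have := ler_norm (- (node X j - t)); rewrite normrN => ?.
  by rewrite ler_norml; apply/andP; split; lra.
- have := @partition_le _ _ _ k.+2 j pX; rewrite jk jn => /(_ isT) h.
  have := ler_norm (node X j - t) => ?.
  by rewrite ler_norml; apply/andP; split; lra.
Qed.

End Nodes.

(** * Energy of a single window *)

Section Almost_everywhere_integrals.
Context {R : realType}.
Local Notation mu := (@lebesgue_measure R).
Variables p q : R.
Local Notation D := `]p, q]%classic.
Implicit Types f g : R -> R.

Lemma aeR_neq (c : R) : aeR (fun x => x != c).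
Proof. by apply: aeRS (ae_neq_seq (cst c)) => x /(_ 0%N). Qed.

Lemma aeR_itv (P : R -> Prop) :
  aeR (fun x => p < x < q -> P x) -> aeR (fun x => D x -> P x).
Proof.
move=> HP; apply: aeRS (aeRI HP (aeR_neq q)) => x [H xq].
rewrite /= in_itv /= => /andP[px]; rewrite le_eqVlt (negbTE xq) /= => xq'.
by apply: H; rewrite px.
Qed.

Lemma eq_ae_Rintegral f g : mu.-integrable D (EFin \o f) ->
  mu.-integrable D (EFin \o g) -> aeR (fun x => p < x < q -> f x = g x) ->
  \int[mu]_(x in D) f x = \int[mu]_(x in D) g x.
Proof.
move=> /integrableP[mf _] /integrableP[mg _] /aeR_itv fg.
by congr fine; apply: ae_eq_integral => //; apply: aeRS fg => x H Dx /=; rewrite H.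
Qed.

Lemma ae_ge0_Rintegral f : mu.-integrable D (EFin \o f) ->
  aeR (fun x => p < x < q -> 0 <= f x) ->
  \int[mu]_(x in D) f x = \int[mu]_(x in D) `|f x|.
Proof.
move=> If f0; apply: eq_ae_Rintegral => //; first exact: integrable_norm.
by apply: aeRS f0 => x H /H; move=> ?; rewrite ger0_norm.
Qed.

Lemma ae_le_Rintegral f g : mu.-integrable D (EFin \o f) ->
  mu.-integrable D (EFin \o g) -> aeR (fun x => p < x < q -> f x <= g x) ->
  \int[mu]_(x in D) f x <= \int[mu]_(x in D) g x.
Proof.
move=> If Ig fg; rewrite -subr_ge0 -RintegralB // ae_ge0_Rintegral.
- by apply: Rintegral_ge0.
- exact: integrable_EFinB.
- by apply: aeRS fg => x H /H; rewrite subr_ge0.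
Qed.

Lemma ae_eq_Rintegral f g : mu.-integrable D (EFin \o f) ->
  mu.-integrable D (EFin \o g) -> aeR (fun x => p < x < q -> f x <= g x) ->
  \int[mu]_(x in D) f x = \int[mu]_(x in D) g x ->
  aeR (fun x => p < x < q -> f x = g x).
Proof.
move=> If Ig fg E.
have IB := integrable_EFinB (measurable_itv _) Ig If.
have : \int[mu]_(x in D) `|g x - f x| = 0.
  rewrite -ae_ge0_Rintegral //; first by rewrite RintegralB // E subrr.
  by apply: aeRS fg => x H /H; rewrite subr_ge0.
move=> E0.
have H : aeR (fun x => D x -> (g x - f x)%:E = 0%:E).
  apply/(@ae_eq_integral_abs _ _ _ mu D (measurable_itv _) (EFin \o (g \- f))) => //.
    by case/integrableP: IB.
  rewrite -[LHS]fineK; last exact/integrable_fin_num/integrable_abse.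
  by congr EFin; rewrite -[RHS]E0.
apply: aeRS H => x H xpq; have [] : (g x - f x)%:E = 0%:E.
  by apply: H; rewrite /= in_itv /=; case/andP: xpq => -> /ltW.
by move/eqP; rewrite subr_eq0 => /eqP.
Qed.

Definition ind (a b : R) : R -> R := \1_`]a, b[%classic.

Lemma indE a b x : ind a b x = (a < x < b)%R%:R.
Proof. by rewrite /ind indicE mem_setE in_itv. Qed.

Lemma ind1 a b x : a < x < b -> ind a b x = 1.
Proof. by rewrite indE => ->. Qed.

Lemma ind0l a b x : x <= a -> ind a b x = 0.
Proof. by move=> xa; rewrite indE ltNge xa. Qed.

Lemma ind0r a b x : b <= x -> ind a b x = 0.
Proof. by move=> xb; rewrite indE andbC ltNge xb. Qed.

Lemma ind_ge0 a b x : 0 <= ind a b x.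
Proof. by rewrite indE. Qed.

Lemma ind_le1 a b x : ind a b x <= 1.
Proof. by rewrite indE lern1 leq_b1. Qed.

Lemma integrable_ind c a b : mu.-integrable D (EFin \o (fun x => c * ind a b x)).
Proof.
apply: integrable_EFinZl => //; apply: (@bounded_integrable_itv _ _ 1).
  exact: measurable_indic.
by move=> x; rewrite indE; case: (_ < _ < _); rewrite ?normr1 ?normr0.
Qed.

Lemma Rintegral_ind c a b : p <= a -> a <= b -> b <= q ->
  \int[mu]_(x in D) (c * ind a b x) = c * (b - a).
Proof.
move=> pa ab bq.
rewrite RintegralZl //; last first.
  by apply: eq_integrable (integrable_ind 1 a b) => // x _; rewrite /= mul1r.
congr *%R; rewrite -[RHS]mul1r -Rintegral_itvoo_cst //.
rewrite [LHS](Rintegral_mkcond mu) [RHS](Rintegral_mkcond mu).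
apply: eq_Rintegral => x _; rewrite /patch indE !mem_setE !in_itv /=.
case: ifP => //; case: (boolP (a < x < b)) => // /andP[ax xb] /negP[].
by rewrite (le_lt_trans pa ax) (ltW (lt_le_trans xb bq)).
Qed.

End Almost_everywhere_integrals.

(** * A window ]p, q] with a single transition from A to B, at distance at most d from t *)

Section Window.
Context {R : realType}.
Local Notation mu := (@lebesgue_measure R).
Variables (p q t d l A B M : R) (theta f : R -> R).
Local Notation D := `]p, q]%classic.
Hypothesis d_gt0 : 0 < d.
Hypothesis dl : 18 * d <= l.
Hypothesis pt : p <= t - l / 2.
Hypothesis tq : t + l / 2 <= q.
Hypothesis AB : A != B.
Hypothesis mtheta : measurable_fun setT theta.
Hypothesis theta_bnd : forall x, `|theta x| <= M.
Hypothesis f_int : mu.-integrable D (EFin \o f).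
Hypothesis fE : aeR (fun x => p < x < q ->
  [/\ f x = A + (B - A) * theta x, 0 <= theta x <= 1,
      (x <= t - d -> theta x = 0) & (t + d <= x -> theta x = 1)]).

Let ineqs : [/\ 0 < d, 18 * d <= l, p <= t - l / 2 & t + l / 2 <= q].
Proof. by []. Qed.
Let ptd : p <= t - d. Proof. case: ineqs; lra. Qed.
Let tdq : t + d <= q. Proof. case: ineqs; lra. Qed.
Let tdd : t - d <= t + d. Proof. case: ineqs; lra. Qed.
Let h := `|B - A|.
Let h_gt0 : 0 < h. Proof. by rewrite normr_gt0 subr_eq0 eq_sym. Qed.

(** By [distA] and [distB] this is the distance from [f x] to the two-point set {A, B}. *)
Definition window_dist x := h * Num.min (theta x) (1 - theta x).
Definition window_cost := \int[mu]_(x in D) window_dist x.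

Lemma window_dist_integrable : mu.-integrable D (EFin \o window_dist).
Proof.
apply: integrable_EFinZl => //.
apply: (@bounded_integrable_itv _ _ (1 + M)).
  by apply: measurable_minr => //; exact: measurable_funB.
move=> x; have := theta_bnd x; rewrite !ler_norml => /andP[? ?].
rewrite /Num.min; case: ifP => _; apply/andP; split; lra.
Qed.

Let dist_int u : mu.-integrable D (EFin \o u) ->
  mu.-integrable D (EFin \o (fun x => `|u x - f x|)).
Proof. by move=> Iu; apply: integrable_norm; exact: integrable_EFinB. Qed.

Let distA x : f x = A + (B - A) * theta x -> 0 <= theta x <= 1 ->
  `|A - f x| = h * theta x.
Proof.
move=> -> /andP[th0 _]; have -> : A - (A + (B - A) * theta x) = - ((B - A) * theta x) by lra.
by rewrite normrN normrM [X in _ * X]ger0_norm.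
Qed.

Let distB x : f x = A + (B - A) * theta x -> 0 <= theta x <= 1 ->
  `|B - f x| = h * (1 - theta x).
Proof.
move=> -> /andP[_ th1]; have -> : B - (A + (B - A) * theta x) = (B - A) * (1 - theta x) by lra.
by rewrite normrM [X in _ * X]ger0_norm //; lra.
Qed.

(** The minimum of theta and 1 - theta is at most 1/2 and vanishes outside an interval of length
    2d. *)
Lemma window_cost_le : window_cost <= d * h.
Proof.
have -> : d * h = h / 2 * ((t + d) - (t - d)) by lra.
rewrite -(@Rintegral_ind _ p q) //.
apply: ae_le_Rintegral; [exact: window_dist_integrable|exact: integrable_ind|].
apply: aeRS fE => x H /H [_ /andP[th0 th1] T0 T1]; rewrite indE /window_dist.
have [x1|x1] := leP x (t - d); first by rewrite T0 // min_l ?mulr0 ?subr0.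
have [x2|x2] := leP (t + d) x.
  by rewrite T1 // subrr min_r ?mulr0 // /= mulr0.
rewrite mulr1 ler_pM2l //; rewrite ge_min; case: (leP (theta x) 2^-1) => //= ?; lra.
Qed.

Lemma window_cost_ge0 : 0 <= window_cost.
Proof.
rewrite /window_cost ae_ge0_Rintegral; [exact: Rintegral_ge0|exact: window_dist_integrable|].
apply: aeRS fE => x H /H [_ /andP[th0 th1] _ _].
by rewrite mulr_ge0 // ?normr_ge0 // le_min th0 subr_ge0.
Qed.

(** Each side of t contains a plateau of length at least l/2 - d. Cutting both to this common length
    allows the triangle inequality |c - A| + |c - B| >= h. *)
Lemma window_flat u c : mu.-integrable D (EFin \o u) ->
  aeR (fun x => p < x < q -> u x = c) ->
  h * (l / 2 - d) <= \int[mu]_(x in D) `|u x - f x|.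
Proof.
move=> Iu uc; have [d0 dl' pt' tq'] := ineqs.
apply: (@le_trans _ _ (\int[mu]_(x in D)
  (`|c - A| * ind (t - l / 2) (t - d) x + `|c - B| * ind (t + d) (t + l / 2) x))).
  rewrite RintegralD ?Rintegral_ind //; try lra; try exact: integrable_ind.
  have : h <= `|c - A| + `|c - B|.
    by rewrite addrC (distrC c B); exact: ler_distD.
  move: `|c - A| `|c - B| => x y hxy.
  have -> : t - d - (t - l / 2) = l / 2 - d by lra.
  have -> : t + l / 2 - (t + d) = l / 2 - d by lra.
  by rewrite -mulrDl ler_wpM2r //; lra.
apply: ae_le_Rintegral; last 1 first.
- apply: aeRS (aeRI uc fE) => x [ux H] xpq; rewrite ux //.
  have [fx th01 T0 T1] := H xpq; rewrite !indE.
  have [/andP[x1 x2]|_] := boolP (t - l / 2 < x < t - d).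
    have -> : (t + d < x < t + l / 2) = false by apply/negP => /andP[]; lra.
    by rewrite fx T0 ?mulr0 ?addr0 ?mulr1; lra.
  rewrite mulr0 add0r; case: (boolP (_ < _ < _)) => [/andP[x1 x2]|_].
    rewrite fx T1 ?mulr1; last lra.
    by have -> : A + (B - A) = B by lra.
  by rewrite mulr0 normr_ge0.
- by apply: integrable_EFinD => //; exact: integrable_ind.
- exact: dist_int.
Qed.

Lemma window_step u x : p < x < q -> mu.-integrable D (EFin \o u) ->
  aeR (fun y => p < y < x -> u y = A /\ theta y <= 2^-1) ->
  aeR (fun y => x < y < q -> u y = B /\ 2^-1 <= theta y) ->
  \int[mu]_(y in D) `|u y - f y| = window_cost.
Proof.
move=> /andP[px xq] Iu uA uB; apply: eq_ae_Rintegral.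
- exact: dist_int.
- exact: window_dist_integrable.
apply: aeRS (aeRI (aeRI uA uB) (aeRI fE (aeR_neq x))) => y [[{}uA {}uB] [H yx]].
move=> /[dup] ypq /andP[py yq]; have [fy th01 T0 T1] := H ypq.
move: yx; rewrite neq_lt => /orP[yx|xy].
  have [|-> th] := uA; first by rewrite py.
  by rewrite distA // /window_dist min_l //; lra.
have [|-> th] := uB; first by rewrite xy.
by rewrite distB // /window_dist min_r //; lra.
Qed.

Section one_jump.
Variables (u : R -> R) (x a b : R).
Hypothesis pxq : p < x < q.
Hypothesis u_int : mu.-integrable D (EFin \o u).
Hypothesis uA : aeR (fun y => p < y < x -> u y = a).
Hypothesis uB : aeR (fun y => x < y < q -> u y = b).

(** The jump x cuts the left plateau and the transition zone, leaving ]p, b1[ and ]t - d,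
    b2[ on its left; on its right remain ]c2, t + d[ of the zone and ]c1, q[ of the right plateau.
    Clamping gives an absent piece of the zone length 0. *)
Let b1 := Num.min x (t - d).
Let b2 := Num.max (t - d) (Num.min x (t + d)).
Let c1 := Num.max x (t + d).
Let c2 := Num.min (t + d) (Num.max x (t - d)).

(* Outside the transition zone u pays the full distance of its value to the
   plateau, inside it the triangle inequality loses at most that distance. *)
Let pointwise y : p < y < q -> y != x ->
  (p < y < x -> u y = a) -> (x < y < q -> u y = b) ->
  [/\ f y = A + (B - A) * theta y, 0 <= theta y <= 1,
      (y <= t - d -> theta y = 0) & (t + d <= y -> theta y = 1)] ->
  window_dist y + (`|a - A| * ind p b1 y + `|b - B| * ind c1 q y) <=
  `|u y - f y| + (`|a - A| * ind (t - d) b2 y + `|b - B| * ind c2 (t + d) y).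
Proof.
move=> /andP[py yq] yx uyA uyB [fy th01 T0 T1].
have dA := distA fy th01; have dB := distB fy th01.
have mA : window_dist y <= `|A - f y|.
  by rewrite dA ler_pM2l // ge_min lexx.
have mB : window_dist y <= `|B - f y|.
  by rewrite dB ler_pM2l // ge_min lexx orbT.
have nA := normr_ge0 (a - A); have nB := normr_ge0 (b - B).
have iA r s : 0 <= `|a - A| * ind r s y by rewrite mulr_ge0 ?ind_ge0.
have iB r s : 0 <= `|b - B| * ind r s y by rewrite mulr_ge0 ?ind_ge0.
have iA1 r s : `|a - A| * ind r s y <= `|a - A| by rewrite ler_piMr ?ind_le1.
have iB1 r s : `|b - B| * ind r s y <= `|b - B| by rewrite ler_piMr ?ind_le1.
have wd0 : y <= t - d -> window_dist y = 0.
  by move=> ?; rewrite /window_dist T0 // min_l ?mulr0 ?subr0.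
have wd1 : t + d <= y -> window_dist y = 0.
  by move=> ?; rewrite /window_dist T1 // subrr min_r ?mulr0.
have b1t : b1 <= t - d by rewrite ge_min lexx orbT.
have b1x : b1 <= x by rewrite ge_min lexx.
have c1t : t + d <= c1 by rewrite le_max lexx orbT.
have c1x : x <= c1 by rewrite le_max lexx.
have := normr_ge0 (u y - f y).
have := iA (t - d) b2; have := iB c2 (t + d).
move: yx; rewrite neq_lt => /orP[yx|xy].
  have uy : u y = a by rewrite uyA // py.
  rewrite (@ind0l _ c1 q) ?mulr0; last exact: le_trans (ltW yx) c1x.
  have [y1|y1] := ltP y (t - d).
    have -> : f y = A by rewrite fy T0 ?mulr0 ?addr0 // ltW.
    by rewrite (wd0 (ltW y1)) uy; have := iA1 p b1; lra.
  rewrite (@ind0r _ p b1) ?mulr0; last exact: le_trans b1t y1.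
  have [y2|y2] := leP (t + d) y; first by rewrite wd1 //; lra.
  move: y1; rewrite le_eqVlt => /predU1P[e|y1]; first by rewrite wd0 -?e //; lra.
  rewrite (@ind1 _ (t - d) b2) ?mulr1; last first.
    by rewrite y1 lt_max lt_min yx y2 orbT.
  by have := ler_distD a A (f y); rewrite uy (distrC A a); lra.
have uy : u y = b by rewrite uyB // xy.
rewrite (@ind0r _ p b1) ?mulr0; last exact: le_trans b1x (ltW xy).
have [y1|y1] := ltP (t + d) y.
  have -> : f y = B by rewrite fy (T1 (ltW y1)); lra.
  by rewrite (wd1 (ltW y1)) uy; have := iB1 c1 q; lra.
rewrite (@ind0l _ c1 q) ?mulr0; last exact: le_trans y1 c1t.
have [y2|y2] := leP y (t - d); first by rewrite wd0 //; lra.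
move: y1; rewrite le_eqVlt => /predU1P[e|y1]; first by rewrite wd1 -?e //; lra.
rewrite (@ind1 _ c2 (t + d)) ?mulr1; last first.
  by rewrite y1 gt_min gt_max xy y2 orbT.
by have := ler_distD b B (f y); rewrite uy (distrC B b); lra.
Qed.

Let excess : `|a - A| * ((b1 - p) - (b2 - (t - d))) +
    `|b - B| * ((q - c1) - (t + d - c2)) <=
  \int[mu]_(y in D) `|u y - f y| - window_cost.
Proof.
have [d0 dl' pt' tq'] := ineqs; have /andP[px xq] := pxq.
have Iwd := window_dist_integrable; have Iu := dist_int u_int.
have I1 c r s : mu.-integrable D (EFin \o (fun y => c * ind r s y)).
  exact: integrable_ind.
have I2 c c' r r' s s' :
    mu.-integrable D (EFin \o (fun y => c * ind r s y + c' * ind r' s' y)).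
  exact: integrable_EFinD.
have le_int : \int[mu]_(y in D)
    (window_dist y + (`|a - A| * ind p b1 y + `|b - B| * ind c1 q y)) <=
  \int[mu]_(y in D)
    (`|u y - f y| + (`|a - A| * ind (t - d) b2 y + `|b - B| * ind c2 (t + d) y)).
  apply: ae_le_Rintegral; [exact: integrable_EFinD|exact: integrable_EFinD|].
  apply: aeRS (aeRI (aeRI uA uB) (aeRI fE (aeR_neq x))) => y [[uyA uyB] [H yx]] ypq.
  exact: pointwise ypq yx uyA uyB (H ypq).
have b1p : p <= b1 by rewrite le_min ltW //; lra.
have b1q : b1 <= q by rewrite ge_min ltW.
have b2l : t - d <= b2 by rewrite le_max lexx.
have b2q : b2 <= q by rewrite ge_max ge_min (ltW xq) andbT; lra.
have c1p : p <= c1 by rewrite le_max ltW.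
have c1q : c1 <= q by rewrite ge_max ltW //=; lra.
have c2p : p <= c2 by rewrite le_min le_max (ltW px) andbT; lra.
have c2r : c2 <= t + d by rewrite ge_min lexx.
move: le_int; rewrite !RintegralD // !Rintegral_ind // -/window_cost.
by rewrite !mulrBr; lra.
Qed.

(** If x is left of the zone, the zone piece is empty and x - p is positive. Otherwise the whole
    left plateau counts, of length at least l/2 - d >= 8d, against a zone of width 2d. The mirror
    image is [gapB]. *)
Let gapA : 0 < (b1 - p) - (b2 - (t - d)).
Proof.
have [d0 dl' pt' tq'] := ineqs; have /andP[px xq] := pxq; rewrite /b1 /b2.
have [x1|x1] := leP x (t + d).
  by have [x2|x2] := leP x (t - d); have [x3|x3] := leP (t - d) x; lra.
by have [x2|x2] := leP x (t - d); have [x3|x3] := leP (t - d) (t + d); lra.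
Qed.

Let gapB : 0 < (q - c1) - (t + d - c2).
Proof.
have [d0 dl' pt' tq'] := ineqs; have /andP[px xq] := pxq; rewrite /c1 /c2.
have [x1|x1] := leP x (t - d).
  by have [x2|x2] := leP x (t + d); have [x3|x3] := leP (t + d) (t - d); lra.
by have [x2|x2] := leP x (t + d); have [x3|x3] := leP (t + d) x; lra.
Qed.

Lemma window_jump_le : window_cost <= \int[mu]_(y in D) `|u y - f y|.
Proof.
rewrite -subr_ge0; apply: le_trans excess.
by apply: addr_ge0; apply: mulr_ge0 => //; exact: ltW.
Qed.

(** The gaps multiplying |a - A| and |b - B| in [excess] are positive, so zero excess forces both
    values. Then [pointwise] holds with equality almost everywhere, and the minimum in [window_dist]
    is theta before x and 1 - theta after it. *)
Lemma window_jump_eq : \int[mu]_(y in D) `|u y - f y| = window_cost ->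
  [/\ a = A, b = B, aeR (fun y => p < y < x -> theta y <= 2^-1) &
     aeR (fun y => x < y < q -> 2^-1 <= theta y)].
Proof.
move=> E; have := excess; rewrite E subrr => exc.
have [d0 dl' pt' tq'] := ineqs; have /andP[px xq] := pxq.
have nA := normr_ge0 (a - A); have nB := normr_ge0 (b - B).
have aA : a = A.
  apply/eqP; rewrite -subr_eq0 -normr_eq0 eq_le nA andbT.
  rewrite -(pmulr_lle0 _ gapA); apply: le_trans exc.
  by rewrite lerDl mulr_ge0 // ltW.
have bB : b = B.
  apply/eqP; rewrite -subr_eq0 -normr_eq0 eq_le nB andbT.
  rewrite -(pmulr_lle0 _ gapB); apply: le_trans exc.
  by rewrite lerDr mulr_ge0 // ltW.
have H : aeR (fun y => p < y < q -> window_dist y = `|u y - f y|).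
  apply: ae_eq_Rintegral => //.
  - exact: window_dist_integrable.
  - exact: dist_int.
  apply: aeRS (aeRI (aeRI uA uB) (aeRI fE (aeR_neq x))) => y [[uyA uyB] [H yx]] ypq.
  have := pointwise ypq yx uyA uyB (H ypq).
  by rewrite aA bB !subrr !normr0 !mul0r !addr0.
split => //.
  apply: aeRS (aeRI (aeRI uA H) fE) => y [[uyA {}H] fy] pyx.
  have ypq : p < y < q by case/andP: pyx => -> yx; exact: lt_trans yx xq.
  have [{}fy th01 _ _] := fy ypq; have := H ypq.
  rewrite uyA // aA distA // /window_dist => /(mulfI (lt0r_neq0 h_gt0)).
  by have [] := leP (theta y) (1 - theta y); lra.
apply: aeRS (aeRI (aeRI uB H) fE) => y [[uyB {}H] fy] pyx.
have ypq : p < y < q by case/andP: pyx => xy ->; rewrite (lt_trans px).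
have [{}fy th01 _ _] := fy ypq; have := H ypq.
rewrite uyB // bB distB // /window_dist => /(mulfI (lt0r_neq0 h_gt0)).
by have [] := leP (theta y) (1 - theta y); lra.
Qed.

End one_jump.
End Window.

(** * Jumps of piecewise constant functions *)

Section Piecewise_constant.
Context {R : realType}.
Local Notation mu := (@lebesgue_measure R).
Implicit Types (t a : nat -> R) (u : R -> R).

Lemma I01P (x : R) : I01 x <-> 0 <= x <= 1.
Proof. by rewrite /I01 /= in_itv. Qed.

Section step_representation.
Variables (u : R -> R) (N : nat) (t a : nat -> R).
Hypothesis pt : partition01 N t.
Hypothesis uE : ae_eq mu I01 u (step_fun N t a).

Lemma step_piece k : (k < N)%N -> aeR (fun y => t k < y < t k.+1 -> u y = a k).
Proof.
move=> kN; have [t0 t1 _] := pt; apply: aeRS uE => y H yk.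
rewrite H ?(step_funE _ pt kN yk) //; apply/I01P; case/andP: yk => y1 y2.
have := @partition_le _ _ _ 0 k pt; have := @partition_le _ _ _ k.+1 N pt.
rewrite t0 t1 kN (ltnW kN) leqnn => /(_ isT) ? /(_ isT) ?.
by apply/andP; split; lra.
Qed.

(** Strictly inside a cell both one-sided values would equal the value of the cell, contradicting
    [b != c]. *)
Lemma jumps_partition x : jumps u x -> exists2 i, (0 < i < N)%N & x = t i.
Proof.
move=> [/andP[x0 x1]] [b [c [e [bc e0 ub uc]]]].
have [t0 t1 _] := pt.
have [|k kN /andP[kx]] := partition_find pt (x := x); first by rewrite x0 ltW.
rewrite le_eqVlt => /predU1P[xk|xk].
  exists k.+1 => //=; rewrite ltn_neqAle kN andbT; apply/eqP => kn.
  by move: x1; rewrite xk kn t1 ltxx.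
have uk := step_piece kN; case/negP: bc; apply/eqP.
have [||y /andP[y1 y2] [<- uy]] := @ae_eq_itvoo_exists _ (Num.max (t k) (x - e)) x
    (fun y => u y = b /\ u y = a k).
- by rewrite gt_max kx ltrBlDr ltrDl.
- apply: aeRS (aeRI ub uk) => y [/= Hb Hk] /andP[]; rewrite gt_max => /andP[y1 y2] y3.
  split; first by rewrite Hb //= in_itv /= y2.
  by rewrite Hk // y1 (lt_trans y3).
rewrite uy.
have [||z /andP[z1 z2] [<- uz]] := @ae_eq_itvoo_exists _ x (Num.min (t k.+1) (x + e))
    (fun y => u y = c /\ u y = a k).
- by rewrite lt_min xk ltrDl.
- apply: aeRS (aeRI uc uk) => z [/= Hb Hk] /andP[z3]; rewrite lt_min => /andP[z1 z2].
  split; first by rewrite Hb //= in_itv /= z3.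
  by rewrite Hk // z1 (lt_trans kx).
by rewrite uz.
Qed.

Lemma jump_of_step k : (k.+1 < N)%N -> a k != a k.+1 -> jumps u (t k.+1).
Proof.
move=> kN ak; have [t0 t1 _] := pt; have pl := partition_lt pt.
have h1 : t k < t k.+1 by apply: pl; rewrite ltnSn ltnW.
have h2 : t k.+1 < t k.+2 by apply: pl; rewrite ltnSn.
split.
  apply/andP; split; first by rewrite -t0; apply: pl; rewrite (ltnW kN).
  by rewrite -t1; apply: pl; rewrite kN leqnn.
exists (a k), (a k.+1), (Num.min (t k.+1 - t k) (t k.+2 - t k.+1)); split => //.
- by rewrite lt_min !subr_gt0 h1.
- apply: aeRS (aeRI (step_piece (ltnW kN)) (aeR_neq (t k))) => y [H yk].
  rewrite /= in_itv /= => /andP[y1 y2]; apply: H; rewrite y2 andbT.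
  rewrite lt_neqAle eq_sym yk /=; apply: le_trans (ltW y1).
  by rewrite lerBrDr addrC -lerBrDr ge_min lexx.
- apply: aeRS (aeRI (step_piece kN) (aeRI (aeR_neq (t k.+1)) (aeR_neq (t k.+2)))).
  move=> y [H [yk yk']]; rewrite /= in_itv /= => /andP[y1 y2]; apply: H.
  rewrite y1 /=; apply: (lt_le_trans y2).
  by rewrite -lerBrDl ge_min lexx orbT.
Qed.

(** The representation may repeat a value in adjacent cells. The cells meeting the interval are
    consecutive, and two neighbours with different values would make the breakpoint between them a
    jump inside it. *)
Lemma no_jump_const p q : 0 <= p -> p < q -> q <= 1 ->
  (forall x, p < x < q -> ~ jumps u x) ->
  exists c, aeR (fun y => p < y < q -> u y = c).
Proof.
move=> p0 pq q1 noj.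
pose meets i := t i < q /\ p < t i.+1.
have pl := partition_le pt.
have aij i j : (i <= j < N)%N -> meets i -> meets j -> a i = a j.
  elim: j => [|j IH] /andP[]; first by rewrite leqn0 => /eqP->.
  rewrite leq_eqVlt => /predU1P[-> //|ij] jN [iq ip] [jq jp].
  have pj : p < t j.+1 by apply: (lt_le_trans ip); apply: pl; rewrite ij (ltnW jN).
  have jq' : t j < q.
    by apply: le_lt_trans jq; apply: pl; rewrite leqnSn ltnW.
  have -> : a i = a j by apply: IH => //; rewrite -ltnS ij ltnW.
  apply/eqP/negPn/negP => /(jump_of_step jN); apply: noj.
  by rewrite pj jq.
(* The midpoint merely selects a reference cell that meets the interval. *)
have [|k kN /andP[k1 k2]] := partition_find pt (x := (p + q) / 2).
  by apply/andP; split; lra.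
exists (a k); apply: aeRS (aeRI uE (ae_neq_seq t)) => y [uy yt] ypq.
have y01 : 0 < y <= 1 by case/andP: ypq => *; apply/andP; split; lra.
have [i iN yi] := partition_find pt y01.
have yi' : t i < y < t i.+1 by move: yi; rewrite [y <= _]le_eqVlt (negbTE (yt _)).
rewrite uy ?(step_funE _ pt iN yi') //; last first.
  by apply/I01P; case/andP: y01 => /ltW -> ->.
have mk : meets k by split; lra.
have mi : meets i by case/andP: yi' => *; case/andP: ypq => *; split; lra.
have [ik|ki] := leqP i k; first by apply: aij => //; rewrite ik.
by apply/esym/aij => //; rewrite (ltnW ki).
Qed.

Lemma jumps_finite : finite_set (jumps u).
Proof.
apply: (@sub_finite_set _ _ [set x | x \in [seq t i | i <- iota 0 N]]).
  move=> x /jumps_partition[i /andP[_ iN] ->] /=.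
  by apply: map_f; rewrite mem_iota.
exact: finite_seq.
Qed.

End step_representation.

Definition enumerates_jumps (js : seq R) u :=
  [/\ uniq js, (forall x, x \in js <-> jumps u x) & J u = (size js)%:R%:E].

Lemma enumerates_jumps_exists u : finite_set (jumps u) ->
  exists js, enumerates_jumps js u.
Proof.
move=> fj; exists (enum_fset (fset_set (jumps u))); split.
- exact: fset_uniq.
- by move=> x; rewrite in_fset_set // inE.
- by rewrite /J /counting asboolT.
Qed.

(** * The energy restricted to a subinterval *)

Section local_energy.
Variables (gamma : R) (f u : R -> R) (js : seq R).
Hypothesis u_int : L1 u.
Hypothesis f_int : forall l r b0 b1,
  mu.-integrable [set` Interval (BSide b0 l) (BSide b1 r)] (EFin \o f).
Hypothesis js_u : enumerates_jumps js u.

(** Half-open intervals make the count additive over adjacent windows even when u jumps on a window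
    boundary. *)
Definition njumps (p q : R) := count (fun x => p < x <= q) js.

Definition local_energy (p q : R) : R :=
  gamma * (njumps p q)%:R + \int[mu]_(x in `]p, q]) `|u x - f x|.

Lemma dist_integrable p q b : 0 <= p -> q <= 1 ->
  mu.-integrable [set` Interval (BSide b p) (BRight q)] (EFin \o (fun x => `|u x - f x|)).
Proof.
move=> p0 q1; apply: integrable_norm; apply: integrable_EFinB => //.
apply: integrableS u_int; [exact: measurable_itv|exact: measurable_itv|].
move=> x /=; rewrite in_itv /= => /andP[px xq]; apply/I01P.
by apply/andP; split; [case: b px => /= px; lra|lra].
Qed.

Lemma local_energyD p q r : 0 <= p -> p <= q -> q <= r -> r <= 1 ->
  local_energy p r = local_energy p q + local_energy q r.
Proof.
move=> p0 pq qr r1; rewrite /local_energy addrACA -mulrDr -natrD; congr (_ * _%:R + _).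
  rewrite /njumps; elim: js => //= x s ->; rewrite addnACA; congr addn.
  case: (leP x q) => xq.
    by rewrite (le_trans xq qr) andbT; case: (p < x).
  by rewrite (le_lt_trans pq xq).
rewrite (@itv_bndbnd_setU _ _ _ (BRight q)) ?bnd_simp //.
have dI : [disjoint `]p, q]%classic & `]q, r]%classic].
  apply/disj_setPS => x [] /=; rewrite !in_itv /= => /andP[_ h] /andP[h' _].
  by move: h'; rewrite ltNge h.
apply: Rintegral_setU => //; rewrite -itv_bndbnd_setU ?bnd_simp //.
exact: dist_integrable.
Qed.

Lemma local_energy_sum n (c : nat -> R) : partition01 n c ->
  local_energy 0 1 = \sum_(k < n) local_energy (c k) (c k.+1).
Proof.
move=> pc; have [c0 c1 _] := pc; have pl := partition_le pc.
case: n pc c1 pl => [_ c1|n pc c1 pl]; first by move: c1; rewrite c0; lra.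
suff H k : (k <= n)%N ->
    local_energy 0 (c k.+1) = \sum_(i < k.+1) local_energy (c i) (c i.+1).
  by rewrite -[X in local_energy _ X]c1; apply: H.
elim: k => [|k IH] kn; first by rewrite big_ord1 c0.
rewrite big_ord_recr /= -IH ?(ltnW kn) //; apply: local_energyD => //.
- by rewrite -c0; apply: pl; rewrite /= ltnS ltnW.
- by apply: pl; rewrite leqnSn ltnS.
- by rewrite -c1; apply: pl; rewrite !ltnS kn leqnn.
Qed.

Lemma njumps01 : njumps 0 1 = size js.
Proof.
case: js_u => _ js_jumps _; apply/eqP; rewrite -all_count; apply/allP => x.
by move/js_jumps => [/andP[-> /ltW]].
Qed.

Lemma potts_energyE : potts_energy gamma f u = (local_energy 0 1)%:E.
Proof.
case: js_u => _ _ Ju; rewrite /potts_energy /local_energy njumps01 EFinD EFinM -Ju.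
congr (_ + _)%E; rewrite /L1dist -integral_itv_obnd_cbnd; last first.
  by case/integrableP: (@dist_integrable 0 1 false (lexx _) (lexx _)).
rewrite /Rintegral fineK //; apply: integrable_fin_num => //.
exact: dist_integrable.
Qed.

Lemma njumps_gt0 p q x : jumps u x -> p < x <= q -> (0 < njumps p q)%N.
Proof.
case: js_u => _ js_jumps _ /js_jumps xj pxq; rewrite -has_count.
by apply/hasP; exists x.
Qed.

Lemma njumps_gt1 p q x y : jumps u x -> jumps u y -> x != y ->
  p < x <= q -> p < y <= q -> (1 < njumps p q)%N.
Proof.
case: js_u => ujs js_jumps _ /js_jumps xj /js_jumps yj xy px py.
rewrite /njumps -size_filter; apply: (@uniq_leq_size _ [:: x; y]).
  by rewrite /= inE xy.
by move=> z; rewrite !inE mem_filter => /orP[] /eqP ->; rewrite ?px ?py ?xj ?yj.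
Qed.

End local_energy.
End Piecewise_constant.

(** * Minimal energy *)

Section Jump_sizes.
Context {R : realType}.
Implicit Types (t a : nat -> R).

Lemma hmin_le n a i : (i < n)%N -> hmin n a <= `|a i.+1 - a i|.
Proof.
move=> iN; exact: (bigmin_le_cond _ (fun i : 'I_n => `|a i.+1 - a i|) (j := Ordinal iN)).
Qed.

Lemma hmax_ge n a i : (i < n)%N -> `|a i.+1 - a i| <= hmax n a.
Proof.
move=> iN; exact: (le_bigmax_cond _ (fun i : 'I_n => `|a i.+1 - a i|) (j := Ordinal iN)).
Qed.

Lemma lmin_le n t i : (i < n.+1)%N -> lmin n t <= t i.+1 - t i.
Proof.
move=> iN; exact: (bigmin_le_cond _ (fun i : 'I_n.+1 => t i.+1 - t i) (j := Ordinal iN)).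
Qed.

Lemma hmin_gt0 n t a : (0 < n)%N -> jump_repr n t a -> 0 < hmin n a.
Proof.
move=> n0 [_ aS].
have h0 i : (i < n)%N -> 0 < `|a i.+1 - a i|.
  by move=> /aS; rewrite normr_gt0 subr_eq0 eq_sym.
by apply/bigmin_gtP; split => [|i _]; apply: h0.
Qed.

Lemma lmin_gt0 n t : partition01 n.+1 t -> 0 < lmin n t.
Proof.
by move=> [_ _ tS]; apply/bigmin_gtP; split => // i _; rewrite subr_gt0 tS.
Qed.

(** Since [hmax] is at least [hmin], the denominator 2(8 hmax + hmin) is at least 18 hmin, and hmin
    cancels. *)
Lemma mesh_condition_le (kappa : R) n t a (X : {fset R}) : (0 < n)%N -> 0 < kappa ->
  jump_repr n t a -> mesh_condition kappa n t a X ->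
  18 * (kappa + mesh X) <= lmin n t.
Proof.
move=> n0 k0 ra; have hm0 := hmin_gt0 n0 ra; have [pt _] := ra.
have hmM : hmin n a <= hmax n a by apply: le_trans (hmin_le _ n0) (hmax_ge _ n0).
have m0 := mesh_ge0 X.
rewrite /mesh_condition ler_pdivlMr; last lra.
move: (kappa + mesh X) (hmin n a) (hmax n a) (lmin n t) hm0 hmM (ltr_wpDr m0 k0).
move=> d h H l h0 hH d0 le; rewrite -(ler_pM2l h0); apply: le_trans le.
have : d * h <= d * H by rewrite ler_pM2l.
rewrite !mulrDr !mulrA; lra.
Qed.

End Jump_sizes.

(** * Windows around the jumps of g *)

Section Windows.
Context {R : realType}.
Variables (n : nat) (t : nat -> R).
Hypothesis n_gt0 : (0 < n)%N.
Hypothesis pt : partition01 n.+1 t.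
Let l := lmin n t.

(** The interval from [window k] to [window k.+1] surrounds the jump [t k.+1]: indices shift by one
    because [t 0] is the endpoint 0. The outer windows reach to 0 and 1, hence the two special
    cases. *)
Definition window k : R :=
  if k == 0%N then 0 else if k == n then 1 else (t k + t k.+1) / 2.

Lemma window_lo k : (k < n)%N -> window k <= t k.+1 - l / 2.
Proof.
move=> kn; have := lmin_le t (ltnW kn : (k < n.+1)%N); have := lmin_gt0 pt.
rewrite -/l /window; case: eqP => [->|_]; first by case: pt => ->; lra.
by rewrite ltn_eqF //; lra.
Qed.

Lemma window_hi k : (k < n)%N -> t k.+1 + l / 2 <= window k.+1.
Proof.
move=> kn; have := lmin_le t (kn : (k.+1 < n.+1)%N); have := lmin_gt0 pt.
by rewrite -/l /window /=; case: eqP => [->|_]; [case: pt => _ ->|]; lra.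
Qed.

Lemma window_partition : partition01 n window.
Proof.
split; rewrite /window ?eqxx //; first by rewrite gtn_eqF.
move=> i iN; have := window_lo iN; have := window_hi iN; have := lmin_gt0 pt.
rewrite -/l /window; lra.
Qed.

Definition in_windows s := [/\ s 0%N = 0, s n.+1 = 1 &
  forall k, (k < n)%N -> window k < s k.+1 < window k.+1].

Lemma in_windows_partition s : in_windows s -> partition01 n.+1 s.
Proof.
move=> [s0 s1 sw]; split => // -[_|i].
  by rewrite s0; have /andP[+ _] := sw 0%N n_gt0.
rewrite ltnS => iN; have /andP[_ h] := sw i iN; move: iN.
rewrite leq_eqVlt => /predU1P[iN|/sw/andP[h' _]]; last exact: lt_trans h'.
by move: h; rewrite iN s1 /window gtn_eqF // eqxx.
Qed.

Lemma step_fun_window s (a : nat -> R) k y : in_windows s -> (k < n)%N ->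
  window k < y < window k.+1 -> y != s k.+1 ->
  step_fun n.+1 s a y = if y < s k.+1 then a k else a k.+1.
Proof.
move=> sw kn /andP[y1 y2] ys; have ps := in_windows_partition sw.
have [s0 s1 {}sw] := sw; have /andP[k1 k2] := sw k kn.
move: ys; rewrite neq_lt => /orP[ys|sy].
  rewrite ys (step_funE _ ps (ltnW kn : (k < n.+1)%N)) // ys andbT.
  case: k kn y1 {y2 k1 k2 ys} => [|k] kn y1; first by rewrite s0.
  by have /andP[_ h] := sw k (ltnW kn); exact: lt_trans h y1.
rewrite ltNge (ltW sy) /= (step_funE _ ps (kn : (k.+1 < n.+1)%N)) // sy /=.
move: (kn); rewrite leq_eqVlt => /predU1P[kN|/sw/andP[h _]].
  by move: y2; rewrite kN s1 /window gtn_eqF // eqxx.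
exact: lt_trans y2 h.
Qed.

End Windows.

(** * Summing over the windows: the minimal energy and its equality case *)

Section Minimal_energy.
Context {R : realType}.
Local Notation mu := (@lebesgue_measure R).
Variables (m : sampling) (X : {fset R}) (Phi : R -> R) (kappa gamma : R).
Variables (n : nat) (t a : nat -> R).
Hypothesis Phi_profile : is_profile Phi kappa.
Hypothesis kappa_gt0 : 0 < kappa.
Hypothesis n_gt0 : (0 < n)%N.
Hypothesis repr : jump_repr n t a.
Hypothesis X01 : in01 X.
Hypothesis mesh_cond : mesh_condition kappa n t a X.
Hypothesis gamma_cond : gamma_condition gamma kappa n t a X.

Let pt : partition01 n.+1 t. Proof. by case: repr. Qed.
Let c := window n t.
Let pc : partition01 n c. Proof. exact: window_partition. Qed.
Let l := lmin n t.
Let d := kappa + mesh X.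
Let theta k := data m X (fun y => Phi (y - t k.+1)).
Let fk := data m X (fun y => jump_sum n a (fun i => Phi (y - t i.+1))).

Let dl : 0 < d /\ 18 * d <= l.
Proof.
split; first by have := mesh_ge0 X; have := kappa_gt0; rewrite /d; lra.
exact: mesh_condition_le mesh_cond.
Qed.

Let c01 k : (k <= n)%N -> 0 <= c k <= 1.
Proof.
have [c0 c1 _] := pc; move=> kn.
by rewrite -[X in X <= _]c0 -[X in _ && (_ <= X)]c1 !(partition_le pc) ?leqnn ?kn.
Qed.

(** Jumps belonging to other windows are at distance at least l/2 >= 9d from this one, so the
    earlier transitions are complete and the later ones have not begun. *)
Let window_data k : (k < n)%N -> aeR (fun x => c k < x < c k.+1 ->
  [/\ fk x = a k + (a k.+1 - a k) * theta k x, 0 <= theta k x <= 1,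
      (x <= t k.+1 - d -> theta k x = 0) & (t k.+1 + d <= x -> theta k x = 1)]).
Proof.
move=> kn; apply: aeRS (ae_neq_seq (node X)) => x xn xk.
have [d0 dl'] := dl.
have x01 : 0 < x < 1.
  case/andP: xk => x1 x2; have /andP[? _] := c01 (ltnW kn); have /andP[_ ?] := c01 kn.
  by apply/andP; split; lra.
split.
- rewrite /fk (data_jump_sum _ Phi_profile X01) //.
  apply: jump_sumE => // i.
    move=> ik; apply: (@theta1 _ m X Phi kappa Phi_profile X01) => //.
    have := window_hi pt (ltn_trans ik kn).
    have := @partition_le _ _ _ i.+1 k pc; rewrite ik (ltnW kn) => /(_ isT).
    by case/andP: xk; rewrite -/l -/d -/c; lra.
  move=> /andP[ki iN]; apply: (@theta0 _ m X Phi kappa Phi_profile X01) => //.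
  have := window_lo pt iN.
  have := @partition_le _ _ _ k.+1 i pc; rewrite ki (ltnW iN) => /(_ isT).
  by case/andP: xk; rewrite -/l -/d -/c; lra.
- exact: (@theta01 _ m X Phi kappa Phi_profile X01).
- exact: (@theta0 _ m X Phi kappa Phi_profile X01).
- exact: (@theta1 _ m X Phi kappa Phi_profile X01).
Qed.

Let theta_bnd k x : `|theta k x| <=
  \sum_(i < nint X) `|sample m X (fun y => Phi (y - t k.+1)) i|.
Proof. exact: step_fun_bounded. Qed.

Let fk_int p q b0 b1 :
  mu.-integrable [set` Interval (BSide b0 p) (BSide b1 q)] (EFin \o fk).
Proof. exact: step_fun_integrable. Qed.

Let cost k := window_cost (c k) (c k.+1) (a k) (a k.+1) (theta k).

Let aS k : (k < n)%N -> a k != a k.+1. Proof. by case: repr => _; exact. Qed.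

Definition min_energy : R := \sum_(k < n) (gamma + cost k).

Lemma window_energy u js k : PC u -> enumerates_jumps js u -> (k < n)%N ->
  gamma + cost k <= local_energy gamma fk u js (c k) (c k.+1) /\
  (local_energy gamma fk u js (c k) (c k.+1) = gamma + cost k ->
   exists x, [/\ c k < x < c k.+1, jumps u x,
     aeR (fun y => c k < y < x -> u y = a k /\ theta k y <= 2^-1) &
     aeR (fun y => x < y < c k.+1 -> u y = a k.+1 /\ 2^-1 <= theta k y)]).
Proof.
move=> [u_int [N [s [b [ps us]]]]] ju kn; have [d0 dl'] := dl.
have lo := window_lo pt kn; have hi := window_hi pt kn.
have mth : measurable_fun setT (theta k) by exact: measurable_data.
have wd := window_data kn.
have /andP[ck0 _] := c01 (ltnW kn); have /andP[_ ck1] := c01 kn.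
have ckS : c k < c k.+1 by case: pc => _ _; exact.
have u_int_k : mu.-integrable `]c k, c k.+1] (EFin \o u).
  apply: integrableS u_int; [exact: measurable_itv|exact: measurable_itv|].
  move=> x /=; rewrite in_itv /= => /andP[? ?]; apply/I01P.
  by apply/andP; split; lra.
have cost_le : cost k <= d * `|a k.+1 - a k|.
  exact: window_cost_le d0 dl' lo hi (aS kn) mth (theta_bnd k) wd.
have cost_ge0 : 0 <= cost k.
  exact: window_cost_ge0 mth (theta_bnd k) wd.
have hm := hmin_le a kn; have hM := hmax_ge a kn; have hm0 := hmin_gt0 n_gt0 repr.
have dhM : d * `|a k.+1 - a k| <= d * hmax n a by rewrite ler_pM2l.
have dhm : 0 < d * hmin n a by rewrite mulr_gt0.
have dhm' : d * hmin n a <= d * `|a k.+1 - a k| by rewrite ler_pM2l.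
have lhm : hmin n a * l <= `|a k.+1 - a k| * l by rewrite ler_wpM2r //; lra.
have [g1 g2] : 2 * (d * hmax n a) <= gamma /\
    gamma <= (hmin n a * l) / 2 - d * hmin n a - 6 * (d * hmax n a).
  case/andP: gamma_cond; rewrite -/d -/l => g1 g2; split; first lra.
  by apply: le_trans g2 _; rewrite mulrDl !mulrA; lra.
have g0 : 0 < gamma by lra.
have int_ge0 : 0 <= \int[mu]_(x in `]c k, c k.+1]) `|u x - fk x|.
  exact: Rintegral_ge0.
set E := local_energy _ _ _ _ _ _.
have EE : E = gamma * (njumps js (c k) (c k.+1))%:R +
    \int[mu]_(x in `]c k, c k.+1]) `|u x - fk x| by [].
(* A strict bound makes the equality clause vacuous; this settles every case but that of exactly one
   jump. *)
have strict P : gamma + cost k < E -> gamma + cost k <= E /\ (E = gamma + cost k -> P).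
  by move=> lt; split; [exact: ltW|move=> e; move: lt; rewrite e ltxx].
move: int_ge0 EE; set I := Rintegral _ _ _ => int_ge0 EE.
(* Jumps are sought in the open window: without one u is constant there, and a possible jump at
   [c k.+1] only adds to the energy. *)
have [[x [xw ux]]|noj] := pselect (exists x, c k < x < c k.+1 /\ jumps u x); last first.
  have [v uv] : exists v, aeR (fun y => c k < y < c k.+1 -> u y = v).
    apply: (no_jump_const ps us) => // x xw ux.
    by apply: noj; exists x.
  have := window_flat d0 dl' lo hi (fk_int _ _ _ _) wd u_int_k uv.
  have : 0 <= gamma * (njumps js (c k) (c k.+1))%:R by rewrite mulr_ge0 // ltW.
  (* With h_k = |a k.+1 - a k|, the bounds [g2], [cost_le] and [lhm] reduce the claim to 2 d h_k < d
     hmin + 6 d hmax. *)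
  by move=> ?; rewrite -/I mulrBr => ?; apply: strict; rewrite EE; lra.
have xw' : c k < x <= c k.+1 by case/andP: xw => -> /ltW.
(* The second jump may sit on the right boundary, since the half-open count charges it to this
   window. *)
have [[y [yw [yx uy]]]|only_x] :=
    pselect (exists y, c k < y <= c k.+1 /\ y != x /\ jumps u y).
  have nj := njumps_gt1 ju uy ux yx yw xw'.
  have : gamma * 2 <= gamma * (njumps js (c k) (c k.+1))%:R.
    by rewrite ler_pM2l // ler_nat.
  (* Here gamma >= 2 d hmax exceeds d hmax, which bounds the cost. *)
  by move=> ?; apply: strict; rewrite EE; lra.
have [v1 uv1] : exists v, aeR (fun y => c k < y < x -> u y = v).
  case/andP: xw => x1 x2; apply: (no_jump_const ps us) => //; first lra.
  move=> y /andP[y1 y2] uy; apply: only_x; exists y.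
  by rewrite lt_eqF // y1; split => //; lra.
have [v2 uv2] : exists v, aeR (fun y => x < y < c k.+1 -> u y = v).
  case/andP: xw => x1 x2; apply: (no_jump_const ps us) => //; first lra.
  move=> y /andP[y1 y2] uy; apply: only_x; exists y.
  by rewrite gt_eqF // (ltW y2) (lt_trans x1).
have le := window_jump_le d0 dl' lo hi (aS kn) mth (theta_bnd k) (fk_int _ _ _ _)
  wd xw u_int_k uv1 uv2.
have eq := window_jump_eq d0 dl' lo hi (aS kn) mth (theta_bnd k) (fk_int _ _ _ _)
  wd xw u_int_k uv1 uv2.
have nj : gamma <= gamma * (njumps js (c k) (c k.+1))%:R.
  apply: ler_peMr; first exact: ltW.
  by rewrite ler1n; exact: (njumps_gt0 ju ux xw').
split; first by rewrite EE lerD.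
(* The jump term is at least gamma and the integral at least the cost, so equality of the sums
   forces the integral to equal the cost. *)
move=> eE; have [|eA eB th1 th2] := eq.
  by move: le; rewrite -/(cost k) -/I => ?; lra.
exists x; split => //.
  by apply: aeRS (aeRI uv1 th1) => y [H1 H2] H; rewrite -eA; split; [exact: H1|exact: H2].
by apply: aeRS (aeRI uv2 th2) => y [H1 H2] H; rewrite -eB; split; [exact: H1|exact: H2].
Qed.

Lemma min_energy_le u : PC u -> (min_energy%:E <= potts_energy gamma fk u)%E.
Proof.
move=> PCu; have [u_int [N [s [b [ps us]]]]] := PCu.
have [js ju] := enumerates_jumps_exists (jumps_finite ps us).
rewrite (potts_energyE gamma u_int fk_int ju) lee_fin.
rewrite (local_energy_sum gamma js u_int fk_int pc).
by apply: ler_sum => k _; case: (window_energy PCu ju (ltn_ord k)).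
Qed.

(** The node just left of [t k.+1] is within the mesh size of it. It cannot be an added endpoint 0
    or 1, because these are at distance at least l >= 18d from the jump. *)
Lemma jump_near_X k : (k < n)%N ->
  exists2 z, z \in X & `|z - t k.+1| <= mesh X.
Proof.
move=> kn; have [d0 dl'] := dl; have mX := mesh_ge0 X.
have := lmin_le t (kn : (k.+1 < n.+1)%N); have := lmin_le t (ltn0Sn n).
have [t0 t1 _] := pt.
rewrite t0 subr0 -/l => t1l tl.
have h1 := @partition_le _ _ _ 1 k.+1 pt (ltnW kn : (1 <= k.+1 <= n.+1)%N).
have h2 := @partition_le _ _ _ k.+2 n.+1 pt; rewrite ltnS kn leqnn in h2.
move: (h2 isT); rewrite t1 => {}h2.
have [|j jn /andP[j1 j2]] := partition_find (nodes_partition X01) (x := t k.+1).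
  by apply/andP; split; lra.
have mj := mesh_ge jn; have kd := kappa_gt0.
have dE : d = kappa + mesh X by [].
exists (node X j); last by rewrite ler_norml; apply/andP; split; lra.
have /or3P[/eqP e|/eqP e|//] :=
  introT (nodeP X (node X j)) (ex_intro2 _ _ j (ltnW jn) erefl); lra.
Qed.

Lemma nearest_close k s : (k < n)%N -> nearest X (t k.+1) s ->
  `|s - t k.+1| <= mesh X.
Proof.
by move=> kn [_ near_s]; have [z zX] := jump_near_X kn; apply/le_trans/near_s.
Qed.

(** The added nodes 0 and 1 are at distance at least l from the jump, whereas s is within the mesh
    size of it. *)
Lemma nearest_nearest_node k s : (k < n)%N -> nearest X (t k.+1) s ->
  nearest_node X (t k.+1) s.
Proof.
move=> kn ns; have := nearest_close kn ns; move: ns => [sX near_s] close.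
split.
  by have [|j jn ->] := elimT (nodeP X s); [rewrite sX !orbT|exists j].
move=> j jn.
have := lmin_le t (kn : (k.+1 < n.+1)%N); have := lmin_le t (ltn0Sn n).
have [t0 t1 _] := pt; have [d0 dl'] := dl; have mX := mesh_ge0 X.
rewrite t0 subr0 -/l => t1l tl.
have h1 := @partition_le _ _ _ 1 k.+1 pt (ltnW kn : (1 <= k.+1 <= n.+1)%N).
have h2 := @partition_le _ _ _ k.+2 n.+1 pt; rewrite ltnS kn leqnn in h2.
move: (h2 isT); rewrite t1 => {}h2.
have kd := kappa_gt0; have dE : d = kappa + mesh X by [].
have /or3P[/eqP->|/eqP->|/near_s //] :=
  introT (nodeP X (node X j)) (ex_intro2 _ _ j jn erefl); apply: le_trans close _.
  by rewrite sub0r normrN; apply: le_trans (ler_norm _); lra.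
by apply: le_trans (ler_norm _); lra.
Qed.

Lemma discretization_in_windows s : discretization X n t s -> in_windows n t s.
Proof.
move=> [s0 s1 ns]; split => // k kn.
have := nearest_close kn (ns k.+1 kn); rewrite ler_norml => /andP[? ?].
have lo := window_lo pt kn; have hi := window_hi pt kn; have [d0 dl'] := dl.
have kd := kappa_gt0; have dE : d = kappa + mesh X by [].
by move: lo hi; rewrite -/l => lo hi; apply/andP; split; lra.
Qed.

Lemma step_fun_PCk s : discretization X n t s -> PCk X (step_fun n.+1 s a).
Proof.
move=> ds; have ps := in_windows_partition n_gt0 (discretization_in_windows ds).
have us : ae_eq mu I01 (step_fun n.+1 s a) (step_fun n.+1 s a) by apply: aeR_all.
split.
  split; first exact: step_fun_integrable.
  by exists n.+1, s, a.
move=> x /(jumps_partition ps us)[i /andP[i0 iN] ->] /=.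
by case: ds => _ _ /(_ i); rewrite i0 -ltnS iN => /(_ isT)[].
Qed.

(** One inequality is [min_energy_le]. For the other, the integral over each window equals its cost
    by [window_step], and there are at most n jumps. *)
Lemma step_fun_energy s : discretization X n t s ->
  potts_energy gamma fk (step_fun n.+1 s a) = min_energy%:E.
Proof.
move=> ds; have sw := discretization_in_windows ds.
have ps := in_windows_partition n_gt0 sw.
set u := step_fun _ _ _.
have us : ae_eq mu I01 u u by apply: aeR_all.
have [PCu _] := step_fun_PCk ds.
have u_int : L1 u by case: PCu.
apply/eqP; rewrite eq_le min_energy_le // andbT.
have [js ju] := enumerates_jumps_exists (jumps_finite ps us).
rewrite (potts_energyE gamma u_int fk_int ju) lee_fin.
have E k : (k < n)%N -> \int[mu]_(x in `]c k, c k.+1]) `|u x - fk x| = cost k.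
  move=> kn; have [d0 dl'] := dl.
  have lo := window_lo pt kn; have hi := window_hi pt kn.
  have mth : measurable_fun setT (theta k) by exact: measurable_data.
  have /andP[ck0 _] := c01 (ltnW kn); have /andP[_ ck1] := c01 kn.
  have [_ _ /(_ k kn) skw] := sw; have /andP[s1 s2] : c k < s k.+1 < c k.+1 := skw.
  have [_ _ /(_ k.+1 kn)/(nearest_nearest_node kn) ns] := ds.
  apply: (window_step mth (theta_bnd k) (fk_int _ _ _ _) (window_data kn) skw) => //.
  - exact: step_fun_integrable.
  - apply: aeRS (ae_neq_seq (node X)) => y yn /andP[y1 y2].
    rewrite /u (step_fun_window n_gt0 a sw kn) ?y2 ?y1 ?(lt_trans y2) ?lt_eqF //.
    by split => //; apply: (@theta_left _ m X Phi kappa Phi_profile X01 _ _ _ ns) => //;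
      apply/andP; split; lra.
  - apply: aeRS (ae_neq_seq (node X)) => y yn /andP[y1 y2].
    rewrite /u (step_fun_window n_gt0 a sw kn) ?y2 ?(lt_trans s1) ?gt_eqF //.
    rewrite ltNge (ltW y1) /=.
    by split => //; apply: (@theta_right _ m X Phi kappa Phi_profile X01 _ _ _ ns) => //;
      apply/andP; split; lra.
(* With Potts parameter 0 the additivity of the local energy becomes that of the integral alone. *)
have := local_energy_sum 0 js u_int fk_int pc.
rewrite /local_energy mul0r add0r => ->.
have -> : \sum_(k < n) (0 * (njumps js (c k) (c k.+1))%:R +
   \int[mu]_(x in `]c k, c k.+1]) `|u x - fk x|) = \sum_(k < n) cost k.
  by apply: eq_bigr => k _; rewrite mul0r add0r E.
rewrite /min_energy big_split /= lerD2r sumr_const card_ord -[leRHS]mulr_natr.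
have g0 : 0 <= gamma.
  have [d0 _] := dl; case/andP: gamma_cond => + _; apply: le_trans.
  by rewrite !mulr_ge0 ?(ltW d0) // (le_trans _ (hmax_ge a n_gt0)).
rewrite ler_wpM2l // ler_nat (njumps01 ju).
rewrite -(size_iota 1 n) -(size_map s); apply: uniq_leq_size; first by case: ju.
move=> x; case: ju => _ jsP _ /jsP /(jumps_partition ps us)[i iN ->].
by apply: map_f; rewrite mem_iota add1n.
Qed.

(** The excesses of the windows over gamma plus cost are nonnegative and sum to 0, so each window is
    in the equality case and supplies a jump of u. This jump lies in X, and [theta_nearest] makes it
    nearest to that of g. *)
Lemma energy_eq_discretization u : PCk X u ->
  (potts_energy gamma fk u <= min_energy%:E)%E ->
  exists2 s, discretization X n t s & ae_eq mu I01 u (step_fun n.+1 s a).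
Proof.
move=> [PCu uX]; have [u_int [N [r [b [pr ur]]]]] := PCu.
have [js ju] := enumerates_jumps_exists (jumps_finite pr ur).
rewrite (potts_energyE gamma u_int fk_int ju) lee_fin => Ele.
have E0 : \sum_(k < n) (local_energy gamma fk u js (c k) (c k.+1) - (gamma + cost k)) = 0.
  rewrite sumrB -(local_energy_sum gamma js u_int fk_int pc).
  apply/eqP; rewrite eq_le subr_le0 Ele /= subr_ge0.
  by have := min_energy_le PCu; rewrite (potts_energyE gamma u_int fk_int ju) lee_fin.
have Ek k : (k < n)%N -> local_energy gamma fk u js (c k) (c k.+1) = gamma + cost k.
  move=> kn; apply/eqP; rewrite -subr_eq0; apply/eqP.
  apply: (psumr_eq0P _ E0 (i := Ordinal kn)) => // i _.
  by rewrite subr_ge0; case: (window_energy PCu ju (ltn_ord i)).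
have /choice[x xP] : forall k, exists x, (k < n)%N ->
    [/\ c k < x < c k.+1, jumps u x,
     aeR (fun y => c k < y < x -> u y = a k /\ theta k y <= 2^-1) &
     aeR (fun y => x < y < c k.+1 -> u y = a k.+1 /\ 2^-1 <= theta k y)].
  move=> k; have [kn|] := boolP (k < n)%N; last by exists 0.
  by have [_ /(_ (Ek _ kn))[x xP]] := window_energy PCu ju kn; exists x.
(* The jump found in the k-th window becomes breakpoint [k.+1], between the endpoints 0 and 1. *)
pose s i := if i is k.+1 then if (k < n)%N then x k else 1 else 0.
have sE k : (k < n)%N -> s k.+1 = x k by rewrite /s => ->.
have sw : in_windows n t s.
  split => //; first by rewrite /s ltnn.
  by move=> k kn; rewrite sE //; case: (xP k kn).
exists s.
  split => //; first by rewrite /s ltnn.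
  move=> [//|k] /andP[_ kn]; rewrite sE //; have [xw ux left right] := xP k kn.
  have xX : x k \in X by exact: uX ux.
  have x01 : 0 < x k < 1 by case: ux.
  have [_ near_x] : nearest_node X (t k.+1) (x k).
    apply: (@theta_nearest _ m X Phi kappa Phi_profile X01 _ _ (c k) (c k.+1)) => //.
      by apply: aeRS left => y H /H[].
    by apply: aeRS right => y H /H[].
  split => // z zX; have [|j jn ->] := elimT (nodeP X z); first by rewrite zX !orbT.
  exact: near_x.
have all_w : aeR (fun y => forall k, (k < n)%N ->
    [/\ c k < y < x k -> u y = a k & x k < y < c k.+1 -> u y = a k.+1]).
  apply: ae_foralln => k; have [kn|kn] := boolP (k < n)%N; last exact: aeR_all.
  have [_ _ left right] := xP k kn.
  apply: aeRS (aeRI left right) => y [H1 H2] _.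
  by split => [/H1[]|/H2[]].
apply: aeRS (aeRI all_w (aeRI (ae_neq_seq c) (ae_neq_seq x))) => y [H [yc yx]] /I01P y01.
have [c0 c1 _] := pc.
have y0 : 0 < y <= 1.
  by case/andP: y01 => y0 ->; rewrite lt_neqAle y0 !andbT eq_sym -c0.
have [k kn yk] := partition_find pc y0.
have yk' : c k < y < c k.+1 by move: yk; rewrite [y <= _]le_eqVlt (negbTE (yc _)).
have yxk := yx k; rewrite (step_fun_window n_gt0 a sw kn yk') sE //.
have [H1 H2] := H k kn; case/andP: yk' => y1 y2.
move: yxk; rewrite neq_lt => /orP[yxk|xyk]; first by rewrite yxk H1 // y1.
by rewrite ltNge (ltW xyk) /= H2 // xyk.
Qed.

End Minimal_energy.

(** * Minimizers and convergence *)

Section Minimizers.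
Context {R : realType}.
Local Notation mu := (@lebesgue_measure R).
Implicit Types (X : {fset R}) (u v : R -> R).

Lemma nearest_exists X x : X != fset0 -> exists y, nearest X x y.
Proof.
move=> /fset0Pn[y0 y0X].
have := @arg_minP _ _ X [` y0X]%fset xpredT (fun z : X => `|val z - x|) isT.
move=> [] y _ y_min; exists (val y); split; first exact: valP.
by move=> z zX; exact: (y_min [` zX]%fset).
Qed.

Lemma ereal_inf_attained (S : set (R -> R)) (F : (R -> R) -> \bar R) u : S u ->
  (forall v, S v -> (F u <= F v)%E) -> F u = ereal_inf [set F v | v in S].
Proof.
move=> Su Fu; apply/eqP; rewrite eq_le; apply/andP; split.
  by apply: le_ereal_inf_tmp => _ [v Sv <-]; exact: Fu.
by apply: ereal_inf_lbound; exists u.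
Qed.

Lemma discretization_eq n t a s s' X :
  (forall i, (0 < i <= n)%N -> exists! x, nearest X (t i) x) ->
  discretization X n t s -> discretization X n t s' ->
  step_fun n.+1 s a = step_fun n.+1 s' a.
Proof.
move=> uX [s0 s1 ns] [s0' s1' ns'].
have ss' i : (i <= n.+1)%N -> s i = s' i.
  case: i => [_|i]; first by rewrite s0.
  rewrite ltnS leq_eqVlt => /predU1P[->|iN]; first by rewrite s1.
  have [x [_ xu]] := uX i.+1 iN.
  by rewrite -(xu _ (ns i.+1 iN)) -(xu _ (ns' i.+1 iN)).
apply/funext => x; apply: eq_bigr => i _.
by rewrite !ss' // ltnW.
Qed.

End Minimizers.

(** * Convergence along nested discretizations *)

Section Convergence.
Context {R : realType}.
Local Notation mu := (@lebesgue_measure R).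
Variables (n : nat) (t a : nat -> R).
Hypothesis pt : partition01 n.+1 t.

(** Both step functions have the same values [a], so in jump form their i-th terms differ only
    between [s i.+1] and [t i.+1]. *)
Lemma L1dist_step_fun s u : partition01 n.+1 s ->
  ae_eq mu I01 u (step_fun n.+1 s a) -> measurable_fun I01 u ->
  exists2 r, L1dist u (step_fun n.+1 t a) = r%:E &
    0 <= r <= \sum_(i < n) `|a i.+1 - a i| * `|s i.+1 - t i.+1|.
Proof.
move=> ps us mu_; set g := step_fun n.+1 t a.
pose v x := step_fun n.+1 s a x - g x.
have Iv b : mu.-integrable [set` Interval (BSide b 0) (BRight 1)] (EFin \o (fun x => `|v x|)).
  apply: integrable_norm; apply: integrable_EFinB => //; exact: step_fun_integrable.
exists (\int[mu]_(x in `]0, 1]) `|v x|).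
  transitivity (\int[mu]_(x in I01) `|v x|%:E)%E.
    apply: ae_eq_integral => //.
    - exact: measurable_itv.
    - apply/measurable_EFinP; apply: (measurableT_comp (@normr_measurable _ setT)).
      by apply: measurable_funB => //; apply: measurable_funTS; exact: measurable_step_fun.
    - by case/integrableP: (Iv true).
    - by apply: aeRS us => x H /H /= ->.
  rewrite /I01 -integral_itv_obnd_cbnd; last by case/integrableP: (Iv false).
  by rewrite /Rintegral fineK //; apply: integrable_fin_num => //; exact: Iv.
rewrite Rintegral_ge0 //=.
pose lo i := Num.min (s i.+1) (t i.+1); pose hi i := Num.max (s i.+1) (t i.+1).
pose F i x := `|a i.+1 - a i| * ind (lo i) (hi i) x.
have IF i : (i < n)%N -> mu.-integrable `]0, 1] (EFin \o F i).
  by move=> _; exact: integrable_ind.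
have [IS ES] := integrable_sum_EFin (measurable_itv _) IF.
apply: (@le_trans _ _ (\int[mu]_(x in `]0, 1]) \sum_(i < n) F i x)).
  apply: ae_le_Rintegral => //.
  apply: aeRS (aeRI (ae_neq_seq s) (ae_neq_seq t)) => x [xs xt] x01.
  have x01' : 0 < x <= 1 by case/andP: x01 => -> /ltW.
  rewrite /v /g !step_fun_jump_sum // /jump_sum opprD addrACA subrr add0r -sumrB.
  apply: le_trans (ler_norm_sum _ _ _) _; apply: ler_sum => i _.
  rewrite -mulrBr normrM; apply: ler_wpM2l => //.
  rewrite indE /lo /hi gt_min lt_max.
  have := xs i.+1; have := xt i.+1; rewrite !neq_lt.
  by case: (ltgtP x (t i.+1)); case: (ltgtP x (s i.+1)) => //= _ _ _ _;
     rewrite ?subrr ?subr0 ?sub0r ?normrN ?normr1 ?normr0.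
rewrite ES; apply: ler_sum => i _; rewrite /F.
have [s0 s1 _] := ps; have [t0 t1 _] := pt.
have iN : (0 <= i.+1 <= n.+1)%N by rewrite /= ltnS ltnW.
have iN' : (i.+1 <= n.+1 <= n.+1)%N by rewrite leqnn andbT ltnS ltnW.
have := partition_le ps iN; have := partition_le ps iN'.
have := partition_le pt iN; have := partition_le pt iN'.
rewrite s0 s1 t0 t1 => *.
rewrite Rintegral_ind.
- apply: ler_wpM2l => //; rewrite /hi /lo.
  by case: (leP (s i.+1) (t i.+1)) => ?; [rewrite distrC|]; exact: ler_norm.
- by rewrite /lo le_min; apply/andP.
- by rewrite /lo /hi ge_min !le_max lexx.
- by rewrite /hi ge_max; apply/andP.
Qed.

(** Density gives a close point in some [X k0], and nestedness keeps it in all later sets. *)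
Lemma dense_near (X : nat -> {fset R}) (x e : R) :
  (forall k, (X k `<=` X k.+1)%fset) ->
  I01 `<=` closure (\bigcup_k [set` X k]) -> 0 <= x <= 1 -> 0 < e ->
  exists k0, forall k, (k0 <= k)%N -> exists2 z, z \in X k & `|z - x| < e.
Proof.
move=> XS dX x01 e0.
have [|z [[k0 _ /= zX] xz]] := dX x _ (ball x e) (nbhsx_ballx _ _ e0).
  exact/I01P.
exists k0 => k; elim: k => [|k IH].
  by rewrite leqn0 => /eqP <-; exists z => //; rewrite distrC.
rewrite leq_eqVlt => /predU1P[<-|/IH[w wX we]]; last first.
  by exists w => //; exact: (fsubsetP (XS k)).
by exists z => //; rewrite distrC.
Qed.

Lemma cvg_discretizations (X : nat -> {fset R}) (s : nat -> nat -> R) (u : nat -> R -> R) :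
  (forall k, (X k `<=` X k.+1)%fset) ->
  I01 `<=` closure (\bigcup_k [set` X k]) ->
  (forall k, discretization (X k) n t (s k)) ->
  (forall k, partition01 n.+1 (s k)) ->
  (forall k, measurable_fun I01 (u k)) ->
  (forall k, ae_eq mu I01 (u k) (step_fun n.+1 (s k) a)) ->
  L1dist (u k) (step_fun n.+1 t a) @[k --> \oo] --> 0%E.
Proof.
move=> XS dX ds ps mu_ us.
have /choice[r rP] : forall k, exists r, L1dist (u k) (step_fun n.+1 t a) = r%:E /\
    0 <= r <= \sum_(i < n) `|a i.+1 - a i| * `|s k i.+1 - t i.+1|.
  by move=> k; have [r ? ?] := L1dist_step_fun (ps k) (us k) (mu_ k); exists r.
have -> : (fun k => L1dist (u k) (step_fun n.+1 t a)) = EFin \o r.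
  by apply/funext => k; case: (rP k).
apply: cvg_EFin; first exact: nearW.
apply/cvgrPdist_le => e e0.
(* The summand 1 keeps [H] positive when g has no jump. *)
pose H := 1 + \sum_(i < n) `|a i.+1 - a i|.
have S0 : 0 <= \sum_(i < n) `|a i.+1 - a i| by exact: sumr_ge0.
have H0 : 0 < H by rewrite /H; lra.
have /choice[k0 k0P] : forall i, exists k0, (i < n)%N -> forall k, (k0 <= k)%N ->
    exists2 z, z \in X k & `|z - t i.+1| < e / H.
  move=> i; have [iN|_] := boolP (i < n)%N; last by exists 0%N.
  have ti : 0 <= t i.+1 <= 1.
    have [t0 t1 _] := pt; rewrite -[X in X <= _]t0 -[X in _ && (_ <= X)]t1.
    by rewrite !(partition_le pt) ?leqnn ?andbT //= ltnW.
  have [|k0 k0P] := @dense_near X (t i.+1) (e / H) XS dX ti; first exact: divr_gt0.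
  by exists k0.
near=> k; rewrite sub0r normrN /=.
have kmax : (\max_(i < n) k0 i <= k)%N by near: k; exists (\max_(i < n) k0 i)%N.
have [_ /andP[rk0 rk]] := rP k; rewrite ger0_norm //; apply: le_trans rk _.
apply: (@le_trans _ _ (\sum_(i < n) `|a i.+1 - a i| * (e / H))).
  apply: ler_sum => i _; apply: ler_wpM2l => //.
  have [|z zX ze] := k0P i (ltn_ord i) k.
    by apply: leq_trans kmax; exact: (leq_bigmax (F := fun i : 'I_n => k0 i) i).
  have [_ _ /(_ i.+1 (ltn_ord i))[_ /(_ z zX)]] := ds k.
  by move=> /le_trans; apply; exact: ltW.
rewrite -mulr_suml mulrA ler_pdivrMr // mulrC ler_pM2l // /H; lra.
Unshelve. all: by end_near. Qed.

End Convergence.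

(** * From the minimal energy to the minimizers of the Potts functional *)

Section Potts_minimum.
Context {R : realType}.
Local Notation mu := (@lebesgue_measure R).
Variables (m : sampling) (X : {fset R}) (K : R -> R) (kappa gamma : R).
Variables (n : nat) (t a : nat -> R).
Hypothesis kappa_gt0 : 0 < kappa.
Hypothesis kerK : is_kernel K kappa.
Hypothesis repr : jump_repr n t a.
Hypothesis X01 : in01 X.
Let fk := data m X (convolution K (extend01 n t a)).

Let fkE : fk = data m X (fun y => jump_sum n a (fun i => profile K (y - t i.+1))).
Proof.
rewrite /fk; congr data; apply/funext => y.
by rewrite (convolution_jump_sum kerK) //; case: repr.
Qed.

(** The common interface of the cases with and without jumps: all claims about minimizers are
    derived from these four facts. *)
Definition potts_minimum (min : R) :=
  [/\ (exists s, discretization X n t s),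
      (forall s, discretization X n t s ->
         [/\ partition01 n.+1 s, PCk X (step_fun n.+1 s a) &
           potts_energy gamma fk (step_fun n.+1 s a) = min%:E]),
      (forall u, PC u -> (min%:E <= potts_energy gamma fk u)%E) &
      (forall u, PCk X u -> (potts_energy gamma fk u <= min%:E)%E ->
        exists2 s, discretization X n t s & ae_eq mu I01 u (step_fun n.+1 s a))].

Lemma potts_minimum_minimizers min : potts_minimum min ->
  let Pk := potts gamma X fk in
  [/\ (forall s, discretization X n t s ->
         let gk := step_fun n.+1 s a in
         [/\ is_minimizer Pk gk,
             Pk gk = ereal_inf [set Pk u | u in PCk X] &
             Pk gk = ereal_inf [set potts_energy gamma fk u | u in PCk X]]),
      (forall u, is_minimizer Pk u ->
         exists2 s, discretization X n t s &
           ae_eq mu I01 u (step_fun n.+1 s a)) &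
      ((forall i, (0 < i <= n)%N -> exists! x, nearest X (t i) x) ->
         exists2 u, is_minimizer Pk u &
           forall v, is_minimizer Pk v -> ae_eq mu I01 v u)].
Proof.
move=> [[s0 ds0] ds_facts energy_ge energy_le] Pk.
have PCks s : discretization X n t s -> PCk X (step_fun n.+1 s a).
  by case/ds_facts.
have energyE s : discretization X n t s ->
    potts_energy gamma fk (step_fun n.+1 s a) = min%:E by case/ds_facts.
have PkE u : PCk X u -> Pk u = potts_energy gamma fk u.
  by move=> uX; rewrite /Pk /potts; case: asboolP.
have Pks s : discretization X n t s -> Pk (step_fun n.+1 s a) = min%:E.
  by move=> ds; rewrite PkE; [exact: energyE|exact: PCks].
have mins s : discretization X n t s -> is_minimizer Pk (step_fun n.+1 s a).
  move=> ds; split; first by case: (PCks s ds) => [[]].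
  move=> v _; rewrite Pks // /Pk /potts; case: asboolP => [[PCv _]|_].
    exact: energy_ge.
  by rewrite leey.
have uniq_min u : is_minimizer Pk u -> exists2 s, discretization X n t s &
    ae_eq mu I01 u (step_fun n.+1 s a).
  (* Comparison with the finite energy of a discretization excludes the value +oo, so u lies in
     [PCk X]. *)
  move=> [_ u_min]; have := u_min _ (mins s0 ds0).1; rewrite Pks //.
  rewrite /Pk /potts; case: asboolP => [uX le|_]; last by rewrite leye_eq.
  exact: energy_le.
split => //.
- move=> s ds; split; first exact: mins.
    apply: ereal_inf_attained; first exact: PCks.
    by move=> v [[Lv _] _]; exact: (mins s ds).2.
  rewrite PkE; last exact: PCks.
  apply: ereal_inf_attained; first exact: PCks.
  by move=> v [PCv _]; rewrite energyE //; exact: energy_ge.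
- move=> uX; exists (step_fun n.+1 s0 a); first exact: mins.
  move=> v /uniq_min[s ds]; by rewrite (discretization_eq a uX ds ds0).
Qed.

Lemma potts_minimum_jumps : (0 < n)%N -> mesh_condition kappa n t a X ->
  gamma_condition gamma kappa n t a X -> exists min, potts_minimum min.
Proof.
move=> n0 mc gc; have pK := kernel_profile kerK.
exists (min_energy m X (profile K) gamma n t a); rewrite /potts_minimum fkE.
split.
- have X0 : X != fset0.
    have [z zX _] := jump_near_X kappa_gt0 n0 repr X01 mc n0.
    by apply/fset0Pn; exists z.
  have /choice[y yP] : forall i, exists y, nearest X (t i) y.
    by move=> i; exact: nearest_exists.
  (* Nearest points are chosen at every index and then overwritten at the two ends of [0,1]. *)
  exists (fun i => if i == 0%N then 0 else if i == n.+1 then 1 else y i).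
  split; rewrite ?eqxx // => i /andP[i0 iN].
  by rewrite gtn_eqF // ltn_eqF.
- move=> s ds; split.
  + apply: (in_windows_partition n0).
    exact: (discretization_in_windows kappa_gt0 n0 repr X01 mc ds).
  + exact: (step_fun_PCk kappa_gt0 n0 repr X01 mc ds).
  + exact: (step_fun_energy m pK kappa_gt0 n0 repr X01 mc gc ds).
- exact: (min_energy_le m pK kappa_gt0 n0 repr X01 mc gc).
- exact: (energy_eq_discretization pK kappa_gt0 n0 repr X01 mc gc).
Qed.

(** The data equal the constant [a 0] almost everywhere, so this constant has energy 0, and any u of
    energy at most 0 has zero distance to the data. *)
Lemma potts_minimum_constant : n = 0%N -> 0 < gamma -> potts_minimum 0.
Proof.
move=> n0 g0.
have ps s : discretization X n t s -> partition01 n.+1 s.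
  by rewrite n0 => -[s0 s1 _]; split => // -[] // _; rewrite s0 s1.
have fk_a : aeR (fun x => 0 < x < 1 -> fk x = a 0%N).
  apply: aeRS (ae_neq_seq (node X)) => x xn x01.
  rewrite fkE (data_jump_sum m (kernel_profile kerK) X01) // n0.
  by rewrite /jump_sum big_ord0 addr0.
have step_a s x : discretization X n t s -> 0 < x < 1 -> step_fun n.+1 s a x = a 0%N.
  move=> ds x01; apply: step_funE => //; first exact: ps.
  by move: ds; rewrite n0 => -[-> ->].
have fk_int p q b0 b1 :
    mu.-integrable [set` Interval (BSide b0 p) (BSide b1 q)] (EFin \o fk).
  exact: step_fun_integrable.
have PCks s : discretization X n t s -> PCk X (step_fun n.+1 s a).
  move=> ds; have us : ae_eq mu I01 (step_fun n.+1 s a) (step_fun n.+1 s a).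
    exact: aeR_all.
  split; first by split; [exact: step_fun_integrable|exists n.+1, s, a; split; [exact: ps|]].
  move=> x /(jumps_partition (ps s ds) us)[i].
  by rewrite n0 ltnS; case: i.
have energyE u : PC u -> exists js, enumerates_jumps js u /\
    potts_energy gamma fk u = (local_energy gamma fk u js 0 1)%:E.
  move=> [u_int [N [r [b [pr ur]]]]].
  have [js ju] := enumerates_jumps_exists (jumps_finite pr ur).
  by exists js; split => //; exact: (potts_energyE gamma u_int fk_int ju).
have int_ge0 u : 0 <= \int[mu]_(x in `]0, 1]) `|u x - fk x| by exact: Rintegral_ge0.
split.
- by exists (fun i => if i is _.+1 then 1 else 0); rewrite n0; split => // -[].
- move=> s ds; have [PCu uX] := PCks s ds; split => //; first exact: ps.
  have [js [ju ->]] := energyE _ PCu; congr EFin.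
  have us : ae_eq mu I01 (step_fun n.+1 s a) (step_fun n.+1 s a) by exact: aeR_all.
  rewrite /local_energy (njumps01 ju); case: ju => _ jsP _.
  have -> : js = [::].
    case: js jsP => // x js jsP.
    have /jsP /(jumps_partition (ps s ds) us)[i] : x \in x :: js by rewrite mem_head.
    by rewrite n0 ltnS; case: i.
  rewrite mulr0 add0r (@eq_ae_Rintegral _ _ _ _ (cst 0)).
  + by rewrite Rintegral_cst // mul0r.
  + apply: integrable_norm; apply: integrable_EFinB => //.
    exact: step_fun_integrable.
  + exact: cst_integrable_itv.
  + apply: aeRS fk_a => x H x01.
    by rewrite H // step_a // subrr normr0.
- move=> u PCu; have [js [ju ->]] := energyE _ PCu.
  by rewrite lee_fin addr_ge0 // mulr_ge0 // ltW.
- move=> u [PCu _]; have [js [ju ->]] := energyE _ PCu; rewrite lee_fin => le0.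
  have I0 : \int[mu]_(x in `]0, 1]) `|u x - fk x| = 0.
    apply/eqP; rewrite eq_le int_ge0 andbT; apply: le_trans le0.
    by rewrite lerDr mulr_ge0 // ltW.
  exists (fun i => if i is _.+1 then 1 else 0); first by rewrite n0; split => // -[].
  have u_int : mu.-integrable `]0, 1] (EFin \o (fun x => `|u x - fk x|)).
    by apply: (dist_integrable _ fk_int); [case: PCu|exact: lexx|exact: lexx].
  have u_fk : aeR (fun x => 0 < x < 1 -> 0 = `|u x - fk x|).
    apply: (ae_eq_Rintegral (f := cst 0)) => //; first exact: cst_integrable_itv.
      by apply: aeR_all => x _; exact: normr_ge0.
    by rewrite Rintegral_cst // mul0r I0.
  apply: aeRS (aeRI (aeRI u_fk fk_a) (aeRI (aeR_neq 0) (aeR_neq 1))).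
  move=> x [[H1 H2] [x0 x1]] /I01P /andP[x0' x1'].
  have x01 : 0 < x < 1 by rewrite !lt_neqAle eq_sym x0 x0' x1.
  rewrite step_a //; last by rewrite n0; split => // -[].
  rewrite -H2 //; apply/eqP; rewrite -subr_eq0 -normr_eq0 -H1 //.
Qed.

End Potts_minimum.

Theorem theorem4p5 (R : realType) (K : R -> R) (kappa : R)
    (kappa_gt0 : 0 < kappa) (kerK : is_kernel K kappa)
    (n : nat) (t alpha : nat -> R) (reprg : jump_repr n t alpha)
    (gamma : R) (gamma_cst : n = 0%N -> 0 < gamma) :
  let g := step_fun n.+1 t alpha in
  let f := convolution K (extend01 n t alpha) in
  let admissible (X : {fset R}) :=
    in01 X /\ ((0 < n)%N -> mesh_condition kappa n t alpha X /\
                            gamma_condition gamma kappa n t alpha X) in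
  (forall (m : sampling) (X : {fset R}), admissible X ->
    let fk := data m X f in
    let Pk := potts gamma X fk in
    [/\ (forall s, discretization X n t s ->
           let gk := step_fun n.+1 s alpha in
           [/\ is_minimizer Pk gk,
               Pk gk = ereal_inf [set Pk u | u in PCk X] &
               Pk gk = ereal_inf [set potts_energy gamma fk u | u in PCk X]]),
        (forall u, is_minimizer Pk u ->
           exists2 s, discretization X n t s &
             ae_eq lebesgue_measure I01 u (step_fun n.+1 s alpha)) &
        ((forall i, (0 < i <= n)%N -> exists! x, nearest X (t i) x) ->
           exists2 u, is_minimizer Pk u &
             forall v, is_minimizer Pk v ->
               ae_eq lebesgue_measure I01 v u)])
  /\
  (forall (m : nat -> sampling) (X : nat -> {fset R}),
    (forall k, (X k `<=` X k.+1)%fset) ->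
    I01 `<=` closure (\bigcup_k [set` X k]) ->
    (forall k, admissible (X k)) ->
    forall gk : nat -> R -> R,
      (forall k, is_minimizer (potts gamma (X k) (data (m k) (X k) f)) (gk k)) ->
      L1dist (gk k) g @[k --> \oo] --> 0%E).
Proof.
move=> g f admissible; have [pt _] := reprg.
have minimum m X : admissible X -> exists min, potts_minimum m X K gamma n t alpha min.
  move=> [X01 cond]; have [n0|n_gt0] := posnP n.
    by exists 0; apply: (potts_minimum_constant m kerK reprg X01 n0); exact: gamma_cst.
  have [mc gc] := cond n_gt0.
  exact: (potts_minimum_jumps m kappa_gt0 kerK reprg X01 n_gt0 mc gc).
split.
  move=> m X /(minimum m)[min min_m].
  exact: (potts_minimum_minimizers min_m).
move=> m X XS dX aX u u_min.
have /choice[s sP] : forall k, exists s, discretization (X k) n t s /\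
    ae_eq lebesgue_measure I01 (u k) (step_fun n.+1 s alpha).
  move=> k; have [min min_k] := minimum (m k) _ (aX k).
  have [_ /(_ _ (u_min k))[s ? ?] _] := potts_minimum_minimizers min_k.
  by exists s.
apply: (cvg_discretizations pt XS dX (s := s)) => k.
- by case: (sP k).
- have [min [_ ds_facts _ _]] := minimum (m k) _ (aX k).
  by have [] := ds_facts _ (sP k).1.
- by case: (u_min k) => /integrableP[/measurable_EFinP].
- by case: (sP k).
Qed.
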